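(* Let $0<\gamma<n$ and let $Y$ be a rearrangement-invariant (r.i.) space over $\mathbb{R}^n$ such that $$\psi\in Y(0,\infty),\qquad\text{where } \psi(t)=(1+t)^{\frac{\gamma}{n}-1},\quad t\in(0,\infty). \tag{A}$$ Define the functional $\sigma$ by $$\sigma(f)=\left\|t^{\frac{\gamma}{n}}f^{**}(t)\right\|_{Y(0,\infty)},\qquad f\in\mathcal{M}_+(\mathbb{R}^n).$$ Then $\sigma$ is an r.i. norm and $M_\gamma\colon X\to Y$, where $M_\gamma$ is the fractional maximal operator and $X=X(\sigma)$. Moreover, $X$ is the optimal (largest) r.i. space over $\mathbb{R}^n$ for which $M_\gamma\colon X\to Y$ holds, i.e. $Z\hookrightarrow X$ for every r.i. space $Z$ over $\mathbb{R}^n$ such that $M_\gamma\colon Z\to Y$. Conversely, if (A) is not true, then there does not exist an r.i. space $X$ over $\mathbb{R}^n$ for which $M_\gamma\colon X\to Y$ holds.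
   Context: Let $R$ be $\mathbb{R}^n$ or $(0,\infty)$ with Lebesgue measure $\mu$ (also written $|\cdot|$). $\mathcal{M}(R)$ is the set of measurable functions on $R$ with values in $[-\infty,\infty]$ and $\mathcal{M}_+(R)$ the set of nonnegative ones. For $f\in\mathcal{M}(R)$, $f^*(t)=\inf\{\lambda\in(0,\infty):\mu(\{|f|>\lambda\})\le t\}$ and $f^{**}(t)=\frac1t\int_0^tf^*(s)\,ds$. An r.i. norm on $R$ is a functional $\varrho\colon\mathcal{M}_+(R)\to[0,\infty]$ such that for all $f,g,f_j\in\mathcal{M}_+(R)$ and $\lambda\ge0$: (P1) $\varrho(f)=0$ iff $f=0$ a.e., $\varrho(\lambda f)=\lambda\varrho(f)$, $\varrho(f+g)\le\varrho(f)+\varrho(g)$; (P2) $f\le g$ a.e. implies $\varrho(f)\le\varrho(g)$; (P3) $f_j\nearrow f$ a.e. implies $\varrho(f_j)\nearrow\varrho(f)$; (P4) $\varrho(\chi_E)<\infty$ whenever $\mu(E)<\infty$; (P5) if $\mu(E)<\infty$, then $\int_Ef\,d\mu\le C_E\varrho(f)$ with a constant $C_E$ independent of $f$; (P6) $\varrho(f)=\varrho(g)$ whenever $f^*=g^*$. The r.i. space determined by $\varrho$ is $X(\varrho)=\{f\in\mathcal{M}(R):\varrho(|f|)<\infty\}$, with $\|f\|_{X(\varrho)}=\varrho(|f|)$. For an r.i. space $Y$ over $\mathbb{R}^n$, $Y(0,\infty)$ denotes its representation space, the unique r.i. space over $(0,\infty)$ with $\|f\|_Y=\|f^*\|_{Y(0,\infty)}$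 for all $f$. $T\colon X\to Y$ means there is $C>0$ with $\|Tf\|_Y\le C\|f\|_X$ for all $f\in X$; $X\hookrightarrow Y$ means this for the identity operator. The fractional maximal operator is $M_\gamma f(x)=\sup_{Q\ni x}\frac{1}{|Q|^{1-\gamma/n}}\int_Q|f(y)|\,dy$, $x\in\mathbb{R}^n$, for locally integrable $f$ on $\mathbb{R}^n$, the supremum being over all cubes $Q\subset\mathbb{R}^n$ containing $x$ with edges parallel to the coordinate axes. *)

(* Defs.v *)
From HB Require Import structures.
From mathcomp Require Import all_boot all_order all_algebra.
From mathcomp Require Import all_classical all_reals all_analysis.
From mathcomp Require Import measurable_realfun.

Set Implicit Arguments.
Unset Strict Implicit.
Unset Printing Implicit Defensive.

Import Order.TTheory GRing.Theory Num.Theory.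
Import numFieldNormedType.Exports.

Local Open Scope classical_set_scope.
Local Open Scope ring_scope.
Local Open Scope ereal_scope.

Section tuple_measure.
Context d (T : measurableType d) (R : realType).
Variable m1 : {sigma_finite_measure set T -> \bar R}.

Definition tcons n (p : T * n.-tuple T) : n.+1.-tuple T := [tuple of p.1 :: p.2].

Lemma measurable_tcons n : measurable_fun [set: T * n.-tuple T] (@tcons n).
Proof. exact: measurable_cons. Qed.

Section step.
Variables (n : nat) (m : {sigma_finite_measure set (n.-tuple T) -> \bar R}).

Definition cons_measure : set (n.+1.-tuple T) -> \bar R :=
  pushforward (m1 \x m) (@tcons n).

Let cons_measure0 : cons_measure set0 = 0.
Proof. by rewrite /cons_measure /pushforward preimage_set0 measure0. Qed.

Let cons_measure_ge0 A : 0 <= cons_measure A.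
Proof. by rewrite /cons_measure /pushforward. Qed.

Let cons_measure_sigma_additive : semi_sigma_additive cons_measure.
Proof.
move=> F mF tF mUF; rewrite /cons_measure /pushforward preimage_bigcup.
apply: measure_semi_sigma_additive.
- by move=> k; rewrite -[X in measurable X]setTI; exact: measurable_tcons.
- apply/trivIsetP => /= i j _ _ ij; rewrite -preimage_setI.
  by move/trivIsetP : tF => /(_ _ _ _ _ ij) ->//; rewrite preimage_set0.
- by rewrite -preimage_bigcup -[X in measurable X]setTI; exact: measurable_tcons.
Qed.

HB.instance Definition _ := isMeasure.Build _ _ _ cons_measure
  cons_measure0 cons_measure_ge0 cons_measure_sigma_additive.

Let sigma_finite_prod : sigma_finite setT (m1 \x m).
Proof.
have /sigma_finiteP[F [TF ndF Foo]] := sigma_finiteT m1.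
have /sigma_finiteP[G [TG ndG Goo]] := sigma_finiteT m.
exists (fun k => F k `*` G k).
  rewrite -setXTT TF TG predeqE => -[x y]; split.
    move=> [/= [i _ Fix] [k _ Gky]]; exists (maxn i k) => //; split.
    - by move: x Fix; exact/subsetPset/ndF/leq_maxl.
    - by move: y Gky; exact/subsetPset/ndG/leq_maxr.
  by move=> [k _ []/= ? ?]; split; exists k.
move=> k; have [? ?] := Foo k; have [? ?] := Goo k.
split; first exact: measurableX.
by rewrite product_measure1E// lte_mul_pinfty// ge0_fin_numE.
Qed.

Let cons_measure_sigma_finite : sigma_finite setT cons_measure.
Proof.
have [F TF mF] := sigma_finite_prod.
pose uncons (t : n.+1.-tuple T) : T * n.-tuple T :=
  (thead t, [tuple of behead t]).
have unconsK t : tcons (uncons t) = t by rewrite [RHS]tuple_eta.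
have tconsK p : uncons (@tcons n p) = p.
  by case: p => x t; congr (_, _); exact: val_inj.
have muncons : measurable_fun setT uncons.
  apply/measurable_fun_pairP; split; first exact: measurable_tnth.
  exact: measurable_behead.
exists (fun k => uncons @^-1` F k).
  by rewrite -preimage_bigcup -TF preimage_setT.
move=> k; have [mFk Fkoo] := mF k; split.
  by rewrite -[X in measurable X]setTI; exact: muncons.
rewrite /cons_measure /pushforward -comp_preimage.
rewrite (_ : _ @^-1` _ = F k)//.
by apply/seteqP; split=> p /=; rewrite tconsK.
Qed.

HB.instance Definition _ := Measure_isSigmaFinite.Build _ _ _ cons_measure
  cons_measure_sigma_finite.

End step.

Fixpoint tuple_measure (n : nat) :
    {sigma_finite_measure set (n.-tuple T) -> \bar R} :=
  match n return {sigma_finite_measure set (n.-tuple T) -> \bar R} with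
  | 0%N => \d_ [tuple of [::]]
  | n'.+1 => cons_measure (tuple_measure n')
  end.

End tuple_measure.

(* Lebesgue measure on R^n, the space of n-tuples of reals: the n-fold product
   of the one-dimensional measure, on the product sigma-algebra
   ([borel_lebn]), then its completion ([lebn]), whose measurable sets are the
   Lebesgue measurable ones. *)
Section lebesgue_measure_on_tuples.
Context {R : realType}.
Notation BR := (measurableTypeR R).
Notation mu1 := (@lebesgue_measure R).

Definition borel_lebn (n : nat) :
  {sigma_finite_measure set (n.-tuple BR) -> \bar R} := tuple_measure mu1 n.

Definition box n (a b : n.-tuple R) : set (n.-tuple R) :=
  [set x | forall i, (tnth a i <= tnth x i <= tnth b i)%R].

Lemma measurable_box n (a b : n.-tuple R) :
  measurable (box a b : set (n.-tuple BR)).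
Proof.
rewrite (_ : box a b = \bigcap_(i in [set: 'I_n])
    ((fun x => tnth x i) @^-1` `[tnth a i, tnth b i]%classic)).
  apply: fin_bigcap_measurable => // i _.
  rewrite -[X in measurable X]setTI.
  by apply: (@measurable_tnth _ BR n i) => //; exact: measurable_itv.
apply/seteqP; split=> [x H i _ /=|x H i]; first by rewrite in_itv/=; exact: H.
by have /= := H i I; rewrite in_itv.
Qed.

Lemma borel_lebn_box n (a b : n.-tuple R) :
  (forall i, (tnth a i <= tnth b i)%R) ->
  borel_lebn n (box a b) = (\prod_(i < n) (tnth b i - tnth a i))%:E.
Proof.
elim: n a b => [a b _|n IHn a b ab].
  rewrite big_ord0 [LHS]diracE mem_set//= => -[]//.
case/tupleP: a ab => a0 a; case/tupleP: b => b0 b ab.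
have ab' i : (tnth a i <= tnth b i)%R by have := ab (lift ord0 i); rewrite !tnthS.
have ab0 : (a0 <= b0)%R by have := ab ord0; rewrite !tnth0.
set B := (X in borel_lebn n.+1 X).
have BE : @tcons _ BR n @^-1` B = `[a0, b0]%classic `*` box a b.
  apply/seteqP; split=> [[x t]|[x t] [/= xab tab]] /=.
    move=> H; split; first by have /= := H ord0; rewrite !tnth0 in_itv.
    by move=> i; have := H (lift ord0 i); rewrite !tnthS.
  move: xab; rewrite in_itv/= => xab i.
  by case: (unliftP ord0 i) => [j|] ->; rewrite ?tnthS ?tnth0//; exact: tab.
have {}BE : borel_lebn n.+1 B =
    (mu1 \x borel_lebn n) (`[a0, b0]%classic `*` box a b) by rewrite -BE.
rewrite {}BE product_measure1E//; last exact: measurable_box.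
rewrite [X in _ * X]IHn// [X in X * _](_ : _ = mu1 `[a0, b0]%classic)//.
rewrite lebesgue_measure_itv/= big_ord_recl !tnth0 lte_fin.
under [in RHS]eq_bigr do rewrite !tnthS.
case: ltP => [_|ba]; first by rewrite -EFinB -EFinM.
rewrite mul0e (_ : (b0 - a0 = 0)%R) ?mul0r//.
by apply/eqP; rewrite subr_eq0 eq_le ba.
Qed.

Definition euclidean (n : nat) : measurableType _ :=
  caratheodory_type (borel_lebn n)^*%mu.

Definition lebn (n : nat) : set (euclidean n) -> \bar R :=
  @completed_measure_extension _ _ _ (borel_lebn n).

HB.instance Definition _ n := Measure.on (@lebn n).

Lemma lebn_box n (a b : n.-tuple R) : (forall i, (tnth a i <= tnth b i)%R) ->
  @lebn n (box a b) = (\prod_(i < n) (tnth b i - tnth a i))%:E.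
Proof.
move=> ab; rewrite -borel_lebn_box//; apply: measurable_mu_extE.
exact: measurable_box.
Qed.

End lebesgue_measure_on_tuples.
Arguments euclidean R n : clear implicits.
Arguments lebn R n : clear implicits.

Definition real_line (R : realType) : measurableType _ :=
  caratheodory_type (@wlength R idfun)^*%mu.

Definition leb1 (R : realType) : set (real_line R) -> \bar R :=
  @completed_lebesgue_measure R.

HB.instance Definition _ (R : realType) := Measure.on (@leb1 R).
Arguments leb1 R : clear implicits.

(* A function on (0, oo) is encoded as a total function on R whose values
   outside [posR] are irrelevant. *)
Definition posR (R : realType) : set (real_line R) := `]0%R, +oo[.
Arguments posR R : clear implicits.

(* The notions below are relative to a domain [D] of a measure space [T]; they
   are used with [D = setT] in R^n and with [D = posR R] in R. *)
Section rearrangement_invariant_spaces.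
Context d (T : measurableType d) (R : realType).
Variables (mu : {measure set T -> \bar R}) (D : set T).
Implicit Types (f g : T -> \bar R) (rho : (T -> \bar R) -> \bar R).

Definition Mplus : set (T -> \bar R) :=
  [set f : T -> \bar R | measurable_fun D f /\ forall x, D x -> 0 <= f x].

Definition rearr f (t : R) : \bar R :=
  ereal_inf [set l%:E | l in
    [set l : R | (0 < l)%R /\ mu (D `&` [set x | l%:E < `|f x|]) <= t%:E]].

Definition rearr2 f (t : R) : \bar R :=
  (t^-1)%:E * \int[leb1 R]_(s in `]0%R, t[) rearr f s.

(* Only the values of [rho] on [Mplus] are meaningful. *)
Record ri_norm rho : Prop := RiNorm {
  ri_norm_ge0 : forall f, Mplus f -> 0 <= rho f;
  ri_norm_eq0 : forall f, Mplus f ->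
    (rho f = 0 <-> {ae mu, forall x, D x -> f x = 0});
  ri_normZ : forall f (l : R), Mplus f -> (0 <= l)%R ->
    rho (fun x => l%:E * f x) = l%:E * rho f;
  ri_normD : forall f g, Mplus f -> Mplus g ->
    rho (fun x => f x + g x) <= rho f + rho g;
  ri_norm_le : forall f g, Mplus f -> Mplus g ->
    {ae mu, forall x, D x -> f x <= g x} -> rho f <= rho g;
  ri_norm_fatou : forall (F : (T -> \bar R)^nat) f,
    (forall j, Mplus (F j)) -> Mplus f ->
    {ae mu, forall x, D x ->
      nondecreasing_seq (fun j => F j x) /\ F j x @[j --> \oo] --> f x} ->
    nondecreasing_seq (fun j => rho (F j)) /\ rho (F j) @[j --> \oo] --> rho f;
  ri_norm_indic : forall E : set T, measurable E -> E `<=` D -> mu E < +oo ->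
    rho (fun x => (\1_E x)%:E) < +oo;
  ri_norm_int : forall E : set T, measurable E -> E `<=` D -> mu E < +oo ->
    exists2 C : R, (0 < C)%R &
      forall f, Mplus f -> \int[mu]_(x in E) f x <= C%:E * rho f;
  ri_norm_rearr : forall f g, Mplus f -> Mplus g ->
    (forall t : R, (0 < t)%R -> rearr f t = rearr g t) -> rho f = rho g }.

Definition ri_space rho : set (T -> \bar R) :=
  [set f : T -> \bar R | measurable_fun D f /\ rho (fun x => `|f x|) < +oo].

End rearrangement_invariant_spaces.

Definition bounded_op d d' (T : measurableType d) (T' : measurableType d')
    (R : realType) (D : set T) (D' : set T')
    (rhoX : (T -> \bar R) -> \bar R) (rhoY : (T' -> \bar R) -> \bar R)
    (op : (T -> \bar R) -> (T' -> \bar R)) : Prop :=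
  exists2 C : R, (0 < C)%R & forall f, ri_space D rhoX f ->
    measurable_fun D' (op f) /\
    rhoY (fun x => `|op f x|) <= C%:E * rhoX (fun x => `|f x|).

Section euclidean_space.
Context (R : realType) (n : nat).

(* X(rhobar) is the representation space of X(rho); by Luxemburg's theorem
   such a [rhobar] exists for every [rho], and it is unique on nonnegative
   measurable functions. *)
Definition representation (rho : (euclidean R n -> \bar R) -> \bar R)
    (rhobar : (real_line R -> \bar R) -> \bar R) : Prop :=
  ri_norm (leb1 R) (posR R) rhobar /\
  forall f : euclidean R n -> \bar R, measurable_fun setT f ->
    rho (fun x => `|f x|) = rhobar (rearr (lebn R n) setT f).

Definition cube (a : n.-tuple R) (l : R) : set (euclidean R n) :=
  [set y | forall i, (tnth a i <= tnth y i <= tnth a i + l)%R].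

Definition frac_maximal (gamma : R) (f : euclidean R n -> \bar R)
    (x : euclidean R n) : \bar R :=
  ereal_sup [set ((fine (lebn R n Q) `^ (1 - gamma / n%:R))^-1)%:E *
                 \int[lebn R n]_(y in Q) `|f y| |
    Q in [set Q | exists a l, [/\ (0 < l)%R, Q = cube a l & Q x]]].

End euclidean_space.

(* Main.v *)
From HB Require Import structures.
Require Import Defs.
From mathcomp Require Import all_boot all_order all_algebra.
From mathcomp Require Import all_classical all_reals all_analysis.
From mathcomp Require Import measurable_realfun lra.

Set Implicit Arguments.
Unset Strict Implicit.
Unset Printing Implicit Defensive.

Import Order.TTheory GRing.Theory Num.Theory.
Import numFieldNormedType.Exports.

Local Open Scope classical_set_scope.
Local Open Scope ring_scope.
Local Open Scope ereal_scope.

(** Write alpha = gamma / n, f* for the nonincreasing rearrangement of f and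
    g_f(t) = t^alpha f**(t), so that sigma(f) is the norm of g_f. Everything
    rests on two facts: sigma is an r.i. norm, and the rearrangement of the
    fractional maximal function Mf is controlled by g_f from both sides.

    Of the axioms of an r.i. norm, the triangle inequality is the one with
    real content, f* being far from additive in f. It follows from
      t f**(t) = min over l >= 0 of (t l + the integral of (|f| - l)^+),
    in which the right-hand side is visibly subadditive in f [rearr_int_le],
    [rearr_intE], [rearr_intD]; the formula itself comes from the layer cake
    representation, which says that equimeasurable functions have equal
    integrals [eq_integral_distribution]. Finiteness on indicators is where
    psi is needed, because g_f for f = 1_E is at most (1 + |E|) psi.

    For the upper bound, let s be the total volume of disjoint cubes Q_i that
    a covering argument selects among the cubes on which the fractional
    average of |f| exceeds l. If {Mf > l} has measure above t, then
    3^n s > t, and since x^(1 - alpha) is subadditive,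
      l s^(1 - alpha) <= sum of l |Q_i|^(1 - alpha)
                      <= integral of |f| over the union <= s f**(s),
    that is g_f(s) >= l [lt_measure_frac_maximal]. As t f**(t) is
    nondecreasing, g_f stays above a constant multiple of l on an interval
    of length 3^n s, which is more than t. Hence (Mf)* <= C (g_f)*
    [rearr_frac_maximal_le], and g_f and (g_f)* have the same norm.

    For optimality, f is replaced by an equimeasurable function whose level
    sets are cubes centred at the origin [symmetrization]. At every point of
    the centred cube of volume s its fractional maximal function is at least
    s^alpha f**(s), whence g_f <= C (Mf)* [frac_average_le_symmetrization],
    and boundedness of M from Z to Y bounds sigma by the norm of Z. The
    same lower bound for the indicator of the unit cube, used with s = 1 + t,
    reads psi(t) <= (Mf)*(t) [shifted_power_norm_le]: if M is bounded from
    any r.i. space into Y, then psi belongs to Y(0, oo). *)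

(** * Lebesgue measure on the half-line *)

(** Both are the same outer measure, restricted to different sigma-algebras. *)
Lemma leb1_lebesgue_measure (R : realType) (A : set R) :
  leb1 R A = lebesgue_measure A.
Proof. by []. Qed.

Lemma measurable_real_line (R : realType) (A : set R) :
  measurable (A : set (measurableTypeR R)) ->
  measurable (A : set (real_line R)).
Proof. exact: sub_caratheodory. Qed.

Lemma leb1_sigma_finite (R : realType) : sigma_finite setT (leb1 R).
Proof. exact: (@sigma_finiteT _ _ _ (@completed_lebesgue_measure R)). Qed.

HB.instance Definition _ (R : realType) :=
  Measure_isSigmaFinite.Build _ _ _ (leb1 R) (@leb1_sigma_finite R).

Lemma lebn_sigma_finite (R : realType) n : sigma_finite setT (lebn R n).
Proof.
by apply: completed_measure_extension_sigma_finite; exact: sigma_finiteT.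
Qed.

HB.instance Definition _ (R : realType) n :=
  Measure_isSigmaFinite.Build _ _ _ (lebn R n) (@lebn_sigma_finite R n).

Lemma posRE (R : realType) (x : R) : posR R x <-> (0 < x)%R.
Proof. by rewrite /posR/= in_itv/= andbT. Qed.

Lemma measurable_posR (R : realType) : measurable (posR R).
Proof. by apply: measurable_real_line; exact: measurable_itv. Qed.

Lemma measurable_itv0t (R : realType) (t : R) :
  measurable (`]0%R, t[%classic : set (real_line R)).
Proof. by apply: measurable_real_line; exact: measurable_itv. Qed.

Lemma itv0t_posR (R : realType) (t : R) : `]0%R, t[%classic `<=` posR R.
Proof. by move=> s /=; rewrite in_itv/= => /andP[s0 _]; exact/posRE. Qed.

Lemma leb1_itv0t (R : realType) (t : R) :
  (0 <= t)%R -> leb1 R `]0%R, t[%classic = t%:E.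
Proof.
move=> t0; rewrite leb1_lebesgue_measure lebesgue_measure_itv/= lte_fin.
have [|t0'] := ltP; rewrite ?sube0//.
by congr EFin; apply/eqP; rewrite eq_le t0 t0'.
Qed.

(** * Layer cake formula *)

Section layer_cake.
Context d (T : measurableType d) (R : realType).
Variables (mu : {sigma_finite_measure set T -> \bar R}) (D : set T).
Hypothesis mD : measurable D.

(** Tonelli's theorem for the region between the graph of F and the axis:
    its sections over x have length F x, and its sections at height l are
    the level sets. *)
Lemma layer_cake (F : T -> \bar R) : measurable_fun D F ->
  (forall x, D x -> 0 <= F x) ->
  \int[mu]_(x in D) F x =
  \int[lebesgue_measure]_(l in `[0%R, +oo[) mu (D `&` [set x | l%:E < F x]).
Proof.
move=> mF F0; pose GR := measurableTypeR R.
pose G := F \_ D.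
have mG : measurable_fun setT G by exact/(measurable_restrictT _ mD).
have G0 x : 0 <= G x by apply: erestrict_ge0.
pose A : set (T * GR) := [set p | (0 <= p.2)%R] `&` [set p | p.2%:E < G p.1].
have mA : measurable A.
  apply: measurableI.
    rewrite (_ : [set _ | _] = snd @^-1` `[0%R, +oo[%classic).
      rewrite -[X in measurable X]setTI.
      by apply: measurable_snd => //; exact: measurable_itv.
    by apply/seteqP; split => p /=; rewrite in_itv/= andbT.
  rewrite -[X in measurable X]setTI; apply: measurable_lte => //.
    by apply/measurable_EFinP; exact: measurable_snd.
  by apply: measurableT_comp => //; exact: measurable_fst.
have := indic_fubini_tonelli mu (@lebesgue_measure R) mA.
rewrite indic_fubini_tonelli_FE// indic_fubini_tonelli_GE// => H.
transitivity (\int[mu]_x ((@lebesgue_measure R \o xsection A) x)).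
  rewrite integral_mkcond; apply: eq_integral => x _ /=; rewrite -/(G x).
  have {H}-> : xsection A x = [set s : R | (0 <= s)%R /\ s%:E < G x].
    by apply/seteqP; split => s; rewrite /xsection/= inE.
  have := G0 x; case: (G x) => [r|_|]//.
    rewrite lee_fin => r0.
    rewrite (_ : [set _ | _] = `[0%R, r[%classic).
      rewrite lebesgue_measure_itv/= lte_fin.
      have [|r0'] := ltP; rewrite ?sube0//.
      by congr EFin; apply/eqP; rewrite eq_le r0 r0'.
    by apply/seteqP; split => s /=; rewrite in_itv/= lte_fin => /andP.
  rewrite (_ : [set _ | _] = `[0%R, +oo[%classic).
    by rewrite lebesgue_measure_itv/= ltry.
  by apply/seteqP; split => s /=; rewrite in_itv/= andbT ltry// => -[].
rewrite H [RHS]integral_mkcond; apply: eq_integral => s _ /=.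
rewrite patchE.
case: ifPn => [|]; rewrite ?inE ?notin_setE/= in_itv/= andbT => s0.
  congr (mu _); apply/seteqP.
  split => x; rewrite /ysection/= inE /A/= /G patchE.
    case: ifPn => [/set_mem Dx []//|_ [_]].
    by rewrite lte_fin ltNge s0.
  by move=> [Dx sF]; rewrite mem_set.
rewrite (_ : ysection _ _ = set0) ?measure0//.
by apply/seteqP; split => x //; rewrite /ysection/= inE /A/= => -[].
Qed.

End layer_cake.

Lemma measurable_fun_abse (R : realType) d (T : measurableType d) (D : set T)
    (f : T -> \bar R) :
  measurable_fun D f -> measurable_fun D (fun x => `|f x|).
Proof. by move=> mf; exact: (measurableT_comp (@abse_measurable _ setT)). Qed.

(** By [layer_cake] both sides are the integral of the common distribution
    function. All comparisons between integrals over R^n and integrals over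
    the half-line are made through this lemma. *)
Lemma eq_integral_distribution (R : realType) d d' (T : measurableType d)
    (T' : measurableType d') (mu : {sigma_finite_measure set T -> \bar R})
    (nu : {sigma_finite_measure set T' -> \bar R}) (D : set T) (D' : set T')
    (F : T -> \bar R) (G : T' -> \bar R) : measurable D -> measurable D' ->
  measurable_fun D F -> measurable_fun D' G ->
  (forall x, D x -> 0 <= F x) -> (forall x, D' x -> 0 <= G x) ->
  (forall l : R, (0 <= l)%R ->
    mu (D `&` [set x | l%:E < F x]) = nu (D' `&` [set x | l%:E < G x])) ->
  \int[mu]_(x in D) F x = \int[nu]_(x in D') G x.
Proof.
move=> mD mD' mF mG F0 G0 FG; rewrite (layer_cake mu)// (layer_cake nu)//.
by apply: eq_integral => l; rewrite inE/= in_itv/= andbT; exact: FG.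
Qed.

Lemma measurable_fun_gtP (R : realType) d (T : measurableType d) (D : set T)
    (f : T -> \bar R) :
  (forall l : R, measurable (D `&` [set x | l%:E < f x])) ->
  measurable_fun D f.
Proof.
move=> H mD; apply: (measurability _ (ErealGenOInfty.measurableE R)) => //.
by move=> /= _ [_ [a ->]] <-; rewrite preimage_itvoy; exact: H.
Qed.

Lemma nonincreasing_measurable_posR (R : realType) (f : R -> \bar R) :
  (forall s t : R, (0 < s)%R -> (s <= t)%R -> f t <= f s) ->
  measurable_fun (posR R) (f : real_line R -> \bar R).
Proof.
move=> nf; apply: measurable_fun_gtP => l; apply: measurable_real_line.
apply: is_interval_measurable => x y /=.
move=> [/posRE x0 lx] [/posRE y0 ly] z /andP[xz zy].
have z0 : (0 < z)%R by exact: lt_le_trans xz.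
by split; [exact/posRE|exact/(lt_le_trans ly)/nf].
Qed.

Lemma subset_measure_le (R : realType) d (T : measurableType d)
    (mu : {measure set T -> \bar R}) (A B : set T) :
  measurable A -> measurable B -> A `<=` B -> mu A <= mu B.
Proof. by move=> mA mB; apply: le_measure; rewrite inE. Qed.

Lemma lt_measure_bigcup (R : realType) d (T : measurableType d)
    (mu : {measure set T -> \bar R}) (A : (set T)^nat) (x : \bar R) :
  (forall k, measurable (A k)) -> nondecreasing_seq A ->
  x < mu (\bigcup_k A k) -> exists k, x < mu (A k).
Proof.
move=> mA ndA xA; apply: contrapT => /forallNP H.
have mUA := bigcupT_measurable _ mA.
have /cvg_lim muA := nondecreasing_cvg_mu (mu := mu) mA mUA ndA.
have : mu (\bigcup_k A k) <= x.
  rewrite -muA//; apply: lime_le; last first.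
    by apply: nearW => k; rewrite leNgt; exact/negP/H.
  apply: ereal_nondecreasing_is_cvgn => m k mk.
  by apply: subset_measure_le => //; exact/subsetPset/ndA.
by rewrite leNgt xA.
Qed.

(** * Distribution functions and rearrangements *)

Section rearrangement.
Context d (T : measurableType d) (R : realType).
Variables (mu : {sigma_finite_measure set T -> \bar R}) (D : set T).
Hypothesis mD : measurable D.
Implicit Types (f g : T -> \bar R) (l t : R).

Definition distr f l := mu (D `&` [set x | l%:E < `|f x|]).

Lemma measurable_gt_abse f l : measurable_fun D f ->
  measurable (D `&` [set x | l%:E < `|f x|]).
Proof.
move=> mf.
exact: (emeasurable_fun_o_infty mD (measurable_fun_abse mf)).
Qed.

(** Right continuity of the distribution function, in the form in which it
    is used: {|f| > l} is the increasing union of the sets {|f| > l +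
    1/(k+1)}. *)
Lemma distr_lt_right f l (x : \bar R) : measurable_fun D f -> x < distr f l ->
  exists2 l' : R, (l < l')%R & x < distr f l'.
Proof.
move=> mf; rewrite /distr.
rewrite (_ : D `&` _ = \bigcup_k
    (D `&` [set x | (l + k.+1%:R^-1)%:E < `|f x|])).
  move=> /lt_measure_bigcup[k|i j ij|k xk].
  - exact: measurable_gt_abse.
  - apply/subsetPset => y [Dy /= H]; split=> //=.
    by apply: le_lt_trans H; rewrite lee_fin lerD2l lef_pV2 ?posrE// ler_nat.
  - by exists (l + k.+1%:R^-1)%R => //; rewrite ltrDl.
apply/seteqP; split=> [y [Dy /= ly]|y [k _ [Dy/= H]]]; last first.
  by split=> //=; apply: lt_trans H; rewrite lte_fin ltrDl.
suff [k lk] : exists k, (l + k.+1%:R^-1)%:E < `|f y| by exists k.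
case: (`|f y|) ly => [r| |]//; last by exists 0%N; rewrite ltry.
rewrite lte_fin -subr_gt0 => rl.
have [k _ /(_ k (leqnn k))/= H] := near_infty_natSinv_lt (PosNum rl).
by exists k; rewrite lte_fin -ltrBrDl.
Qed.

Lemma distr_nonincreasing f l l' : measurable_fun D f -> (l <= l')%R ->
  distr f l' <= distr f l.
Proof.
move=> mf ll'; apply: subset_measure_le; try exact: measurable_gt_abse.
by move=> x [Dx /= H]; split => //=; apply: le_lt_trans H; rewrite lee_fin.
Qed.

Lemma rearr_ge0 f t : 0 <= rearr mu D f t.
Proof. by apply/le_ereal_inf_tmp => _ [l [l0 _] <-]; rewrite lee_fin ltW. Qed.

(** The rearrangement is the generalized inverse of the distribution
    function. Right continuity of the latter makes both inequalities strict;
    with it, statements about f* reduce to statements about the measure of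
    level sets. *)
Lemma lt_rearrP f l t : measurable_fun D f -> (0 <= l)%R ->
  (l%:E < rearr mu D f t) = (t%:E < distr f l).
Proof.
move=> mf l0; apply/idP/idP.
  apply: contraTT; rewrite -!leNgt => H.
  apply/lee_addgt0Pr => e e0; apply: ereal_inf_lbound.
  exists (l + e)%R => //; split; first by rewrite ltr_wpDl.
  by apply: le_trans H; apply: distr_nonincreasing; rewrite ?lerDl ?ltW.
move=> /(distr_lt_right mf)[l' ll' tl']; apply: (@lt_le_trans _ _ l'%:E).
  by rewrite lte_fin.
apply/le_ereal_inf_tmp => _ [k [_ kt] <-]; rewrite lee_fin leNgt.
apply: contraL tl' => kl'; rewrite -leNgt.
by apply: le_trans kt; apply: distr_nonincreasing; rewrite ?ltW.
Qed.

Lemma rearr_nonincreasing f s t : (s <= t)%R ->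
  rearr mu D f t <= rearr mu D f s.
Proof.
move=> st; apply: le_ereal_inf => _ [l [l0 H] <-]; exists l => //; split => //.
by apply: le_trans H _; rewrite lee_fin.
Qed.

Lemma measurable_rearr f :
  measurable_fun (posR R) (rearr mu D f : real_line R -> \bar R).
Proof.
by apply: nonincreasing_measurable_posR => s t _; exact: rearr_nonincreasing.
Qed.

Lemma distr_ge0 f l : 0 <= distr f l. Proof. exact: measure_ge0. Qed.

(** By [lt_rearrP] the level set of f* is an open interval starting at 0, of
    length the distribution function of f: f and f* are equimeasurable. *)
Lemma distr_rearr f l : measurable_fun D f -> (0 <= l)%R ->
  leb1 R (posR R `&` [set s | l%:E < rearr mu D f s]) = distr f l.
Proof.
move=> mf l0; rewrite leb1_lebesgue_measure.
rewrite (_ : _ `&` _ = posR R `&` [set s | s%:E < distr f l]); last first.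
  by apply/seteqP; split => s /= [s0]; rewrite lt_rearrP.
have := distr_ge0 f l; case: (distr f l) => [r|_|]//.
  rewrite lee_fin => r0; rewrite (_ : _ `&` _ = `]0%R, r[%classic).
    exact: leb1_itv0t.
  apply/seteqP; split => s /=; rewrite in_itv/= lte_fin.
    by move=> [/posRE -> ->].
  by move=> /andP[s0 sr]; split => //; exact/posRE.
rewrite (_ : _ `&` _ = posR R); first by rewrite lebesgue_measure_itv/= ltry.
by apply/seteqP; split => s /= => [[]|s0]//; split => //; exact: ltry.
Qed.

End rearrangement.

(** * The integral of a rearrangement over an initial interval *)

Section truncation.
Variable R : realType.
Implicit Types (a b : \bar R) (k l : R).

Definition truncate l a : \bar R := maxe (a - l%:E) 0.

Lemma truncate_ge0 l a : 0 <= truncate l a.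
Proof. by rewrite /truncate le_max lexx orbT. Qed.

Lemma lt_truncate k l a : (0 <= k)%R ->
  (k%:E < truncate l a) = ((k + l)%:E < a).
Proof.
move=> k0; rewrite /truncate lt_max lte_fin [X in _ || X]ltNge k0 orbF.
by rewrite lteBrDr// EFinD.
Qed.

Lemma le_truncate l a : a <= l%:E + truncate l a.
Proof.
rewrite /truncate; case: a => [a| |]//=.
- rewrite -EFinB -EFin_max -EFinD lee_fin addrC -lerBlDr.
  by rewrite le_max lexx.
- by rewrite leNye.
Qed.

Lemma truncateE l a : l%:E <= a -> a = l%:E + truncate l a.
Proof.
rewrite /truncate; case: a => [a| |]//=.
- rewrite lee_fin => la.
  by rewrite -EFinB max_l ?lee_fin ?subr_ge0// -EFinD addrC subrK.
Qed.

Lemma truncate0 l a : a <= l%:E -> truncate l a = 0.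
Proof. by move=> al; rewrite /truncate max_r// leeBlDr// add0e. Qed.

(** This subadditivity of the positive part is the source of the triangle
    inequality for f**. *)
Lemma truncateD k l a b : 0 <= a -> 0 <= b ->
  truncate (k + l) (a + b) <= truncate k a + truncate l b.
Proof.
move=> a0 b0; rewrite {1}/truncate ge_max adde_ge0 ?truncate_ge0// andbT.
rewrite leeBlDr// EFinD addeACA leeD//.
  by rewrite addeC le_truncate.
by rewrite addeC le_truncate.
Qed.

Lemma truncate_id a : 0 <= a -> truncate 0 a = a.
Proof. by move=> a0; rewrite /truncate sube0 max_l. Qed.

Lemma measurable_truncate d (T : measurableType d) (D : set T) l
    (f : T -> \bar R) : measurable_fun D f ->
  measurable_fun D (fun x => truncate l (f x)).
Proof.
move=> mf; apply: measurable_maxe; last exact: measurable_cst.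
by apply: emeasurable_funB => //; exact: measurable_cst.
Qed.

End truncation.

Section integral_of_rearrangement.
Context d (T : measurableType d) (R : realType).
Variables (mu : {sigma_finite_measure set T -> \bar R}) (D : set T).
Hypothesis mD : measurable D.
Implicit Types (f g : T -> \bar R) (l t : R).

Definition excess f l := \int[mu]_(x in D) truncate l `|f x|.

(** This is t f**(t). *)
Definition rearr_int f t := \int[leb1 R]_(s in `]0%R, t[) rearr mu D f s.

Lemma measurable_rearr_itv0t f t :
  measurable_fun (`]0%R, t[ : set (real_line R)) (rearr mu D f).
Proof.
apply: measurable_funS (@measurable_rearr _ _ _ _ _ f).
  exact: measurable_posR.
exact: itv0t_posR.
Qed.

Lemma excess_ge0 f l : 0 <= excess f l.
Proof. by apply: integral_ge0 => x _; exact: truncate_ge0. Qed.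

(** Truncation at l translates the distribution function by l, hence
    preserves the equimeasurability of f and f*. *)
Lemma excess_rearr f l : measurable_fun D f -> (0 <= l)%R ->
  excess f l = \int[leb1 R]_(s in posR R) truncate l (rearr mu D f s).
Proof.
move=> mf l0; apply: (@eq_integral_distribution _ _ _ _ _ mu (leb1 R)).
- exact: mD.
- exact: measurable_posR.
- exact/measurable_truncate/measurable_fun_abse.
- exact/measurable_truncate/measurable_rearr.
- by move=> x _; exact: truncate_ge0.
- by move=> x _; exact: truncate_ge0.
- move=> k k0; have kl0 : (0 <= k + l)%R by rewrite addr_ge0.
  rewrite [RHS](_ : _ =
      leb1 R (posR R `&` [set s | (k + l)%:E < rearr mu D f s])).
    rewrite distr_rearr// /distr; congr (mu _).
    by apply/seteqP; split => x /= []; rewrite lt_truncate.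
  congr (leb1 R _).
  by apply/seteqP; split => x /= []; rewrite lt_truncate.
Qed.

Lemma integral_cst_itv0t l t : (0 <= t)%R ->
  \int[leb1 R]_(s in `]0%R, t[) l%:E = (t * l)%:E.
Proof.
move=> t0; rewrite (integral_cst _ (measurable_itv0t t))/=.
by rewrite leb1_itv0t// -EFinM mulrC.
Qed.

Let rearr_int_split f l t : (0 <= l)%R -> (0 <= t)%R ->
  \int[leb1 R]_(s in `]0%R, t[) (l%:E + truncate l (rearr mu D f s)) =
  (t * l)%:E + \int[leb1 R]_(s in `]0%R, t[) truncate l (rearr mu D f s).
Proof.
move=> l0 t0; rewrite (ge0_integralD _ (measurable_itv0t t)).
- by rewrite integral_cst_itv0t.
- by [].
- exact: measurable_cst.
- by move=> x _; exact: truncate_ge0.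
- exact/measurable_truncate/measurable_rearr_itv0t.
Qed.

(** With [rearr_intE], this shows that t f**(t) is the minimum over l of t l
    plus the integral of (|f| - l)^+. The point of the formula is that f
    enters it without being rearranged. *)
Lemma rearr_int_le f l t : measurable_fun D f -> (0 <= l)%R -> (0 <= t)%R ->
  rearr_int f t <= (t * l)%:E + excess f l.
Proof.
move=> mf l0 t0; rewrite excess_rearr//.
apply: (@le_trans _ _
    (\int[leb1 R]_(s in `]0%R, t[) (l%:E + truncate l (rearr mu D f s)))).
  apply: (ge0_le_integral _ (measurable_itv0t t)).
  - by move=> s _; exact: rearr_ge0.
  - exact: measurable_rearr_itv0t.
  - apply: emeasurable_funD; first exact: measurable_cst.
    exact/measurable_truncate/measurable_rearr_itv0t.
  - by move=> s _; exact: le_truncate.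
rewrite rearr_int_split// leeD2l//.
apply: (ge0_subset_integral _ (measurable_itv0t t) (@measurable_posR R)).
- exact/measurable_truncate/measurable_rearr.
- by move=> s _; exact: truncate_ge0.
- exact: itv0t_posR.
Qed.

(** The minimum is attained at l = f*(t), because f* >= l before t and f* <=
    l from t on, so that no truncation is lost on either side. *)
Lemma rearr_intE f l t : measurable_fun D f -> (0 <= l)%R -> (0 < t)%R ->
  rearr mu D f t = l%:E -> rearr_int f t = (t * l)%:E + excess f l.
Proof.
move=> mf l0 t0 ftl; rewrite excess_rearr//.
rewrite (_ : rearr_int f t =
    \int[leb1 R]_(s in `]0%R, t[) (l%:E + truncate l (rearr mu D f s))).
  rewrite (rearr_int_split f l0 (ltW t0)); congr (_ + _).
  rewrite integral_mkcond [RHS]integral_mkcond.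
  apply: eq_integral => s _; rewrite !patchE.
  case: ifPn => [|]; rewrite ?inE ?notin_setE/= in_itv/=.
    by move=> /andP[s0 st]; rewrite ifT// inE; exact/posRE.
  move=> /negP; rewrite negb_and -!leNgt.
  case: ifPn => //; rewrite inE => /posRE s0.
  rewrite leNgt s0/= => ts; rewrite truncate0// -ftl.
  exact: rearr_nonincreasing.
apply: eq_integral => s; rewrite inE/= in_itv/= => /andP[s0 st].
by apply: truncateE; rewrite -ftl; apply: rearr_nonincreasing; exact: ltW.
Qed.

Lemma rearr_int_pinfty f t : (0 < t)%R ->
  rearr mu D f t = +oo -> rearr_int f t = +oo.
Proof.
move=> t0 ft; apply/eqP; rewrite -leye_eq.
rewrite (_ : rearr_int f t = \int[leb1 R]_(s in `]0%R, t[) cst +oo s).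
  rewrite (integral_cst _ (measurable_itv0t t))/=.
  by rewrite (leb1_itv0t (ltW t0)) gt0_mulye.
apply: eq_integral => s; rewrite inE/= in_itv/= => /andP[s0 st].
by apply/eqP; rewrite -leye_eq -ft; apply: rearr_nonincreasing; exact: ltW.
Qed.

Lemma rearr_int_ge0 f t : 0 <= rearr_int f t.
Proof. by apply: integral_ge0 => s _; exact: rearr_ge0. Qed.

Lemma rearr_int_nondecreasing f s t : (s <= t)%R ->
  rearr_int f s <= rearr_int f t.
Proof.
move=> st.
apply: (ge0_subset_integral _ (measurable_itv0t s) (measurable_itv0t t)).
- exact: measurable_rearr_itv0t.
- by move=> *; exact: rearr_ge0.
- move=> x /=; rewrite !in_itv/= => /andP[-> xs]/=; exact: lt_le_trans st.
Qed.

Lemma rearr_int_attained f t : measurable_fun D f -> (0 < t)%R ->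
  rearr_int f t < +oo ->
  exists2 l, (0 <= l)%R & rearr_int f t = (t * l)%:E + excess f l.
Proof.
move=> mf t0 Ioo; have := rearr_ge0 mu D f t.
case E : (rearr mu D f t) => [l| |]//.
  by rewrite lee_fin => l0; exists l => //; exact: rearr_intE.
by move: Ioo; rewrite rearr_int_pinfty.
Qed.

(** If k and l are the levels at which the minima for f and g are attained,
    the level k + l is a competitor for f + g. *)
Lemma rearr_intD f g t : measurable_fun D f -> measurable_fun D g ->
  (forall x, D x -> 0 <= f x) -> (forall x, D x -> 0 <= g x) -> (0 < t)%R ->
  rearr_int (fun x => f x + g x) t <= rearr_int f t + rearr_int g t.
Proof.
move=> mf mg f0 g0 t0.
have Ifoo : rearr_int f t != -oo.
  by rewrite gt_eqF// (lt_le_trans _ (rearr_int_ge0 f t)) ?ltNy0.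
have Igoo : rearr_int g t != -oo.
  by rewrite gt_eqF// (lt_le_trans _ (rearr_int_ge0 g t)) ?ltNy0.
have [If|] := ltP (rearr_int f t) +oo; last first.
  by rewrite leye_eq => /eqP ->; rewrite addye ?leey.
have [Ig|] := ltP (rearr_int g t) +oo; last first.
  by rewrite leye_eq => /eqP ->; rewrite addey ?leey.
have [k k0 ->] := rearr_int_attained mf t0 If.
have [l l0 ->] := rearr_int_attained mg t0 Ig.
have mfg : measurable_fun D (fun x => f x + g x) by exact: emeasurable_funD.
have kl0 : (0 <= k + l)%R by rewrite addr_ge0.
apply: (le_trans (rearr_int_le mfg kl0 (ltW t0))).
rewrite mulrDr EFinD [leRHS]addeACA; apply: leeD2l.
rewrite /excess -ge0_integralD//.
- apply: ge0_le_integral => //.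
  + by move=> *; exact: truncate_ge0.
  + exact/measurable_truncate/measurable_fun_abse.
  + by apply: emeasurable_funD; exact/measurable_truncate/measurable_fun_abse.
  + move=> x Dx; rewrite (gee0_abs (f0 _ Dx)) (gee0_abs (g0 _ Dx)).
    rewrite gee0_abs ?adde_ge0 ?f0 ?g0//.
    by apply: truncateD; [exact: f0|exact: g0].
- by move=> *; exact: truncate_ge0.
- exact/measurable_truncate/measurable_fun_abse.
- by move=> *; exact: truncate_ge0.
- exact/measurable_truncate/measurable_fun_abse.
Qed.

(** Splitting |f| at the minimizing level l, the part below l contributes at
    most l times the measure of E, and the rest at most the excess. *)
Lemma hardy_littlewood f (E : set T) t : measurable_fun D f -> measurable E ->
  E `<=` D -> mu E <= t%:E -> (0 < t)%R ->
  \int[mu]_(x in E) `|f x| <= rearr_int f t.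
Proof.
move=> mf mE ED Et t0.
have [If|] := ltP (rearr_int f t) +oo; last first.
  by rewrite leye_eq => /eqP ->; rewrite leey.
have [l l0 ->] := rearr_int_attained mf t0 If.
have mf' : measurable_fun E (fun x => `|f x|).
  exact: measurable_funS (measurable_fun_abse mf).
apply: (@le_trans _ _ (\int[mu]_(x in E) (l%:E + truncate l `|f x|))).
  apply: ge0_le_integral => //.
  - apply: emeasurable_funD; first exact: measurable_cst.
    exact: measurable_truncate.
  - by move=> *; exact: le_truncate.
rewrite ge0_integralD//; last 2 first.
- by move=> *; exact: truncate_ge0.
- exact: measurable_truncate.
apply: leeD.
  rewrite integral_cst// mulrC EFinM; exact: lee_pmul.
apply: ge0_subset_integral => //.
- exact/measurable_truncate/measurable_fun_abse.
- by move=> *; exact: truncate_ge0.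
Qed.

Lemma rearr_int_le_integral f t : measurable_fun D f -> (0 <= t)%R ->
  rearr_int f t <= \int[mu]_(x in D) `|f x|.
Proof.
move=> mf t0; apply: (le_trans (rearr_int_le mf (lexx 0%R) t0)).
rewrite mulr0 add0e; apply: ge0_le_integral => //.
- by move=> *; exact: truncate_ge0.
- exact/measurable_truncate/measurable_fun_abse.
- exact: measurable_fun_abse.
- by move=> x _; rewrite truncate_id.
Qed.

End integral_of_rearrangement.

(** * Real powers and measurability on the half-line *)

Section powers.
Variable R : realType.
Implicit Types (s t p : R).

Lemma ler_powR_npos p s t : (p <= 0)%R -> (0 < s)%R -> (s <= t)%R ->
  (t `^ p <= s `^ p)%R.
Proof.
move=> p0 s0 st; rewrite -[p]opprK !(powRN _ (- p)).
have t0 := lt_le_trans s0 st.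
have {}p0 : (0 <= - p)%R by rewrite oppr_ge0.
by rewrite lef_pV2 ?posrE ?powR_gt0// ge0_ler_powR ?nnegrE// ltW.
Qed.

(** The quotient of the two powers is ((1 + t) / t)^(1 - p), with base at
    least 1 and exponent at most 1. *)
Lemma powRB1_le t p : (0 <= p <= 1)%R -> (0 < t)%R ->
  (t `^ (p - 1) <= (1 + t) `^ (p - 1) * ((1 + t) / t))%R.
Proof.
move=> /andP[p0 p1] t0; have t10 : (0 < 1 + t)%R by rewrite addr_gt0.
set c := ((1 + t) / t)%R.
have c1 : (1 <= c)%R by rewrite ler_pdivlMr// mul1r lerDr.
have c0 : (0 < c)%R by rewrite (lt_le_trans ltr01).
have -> : (t `^ (p - 1) = (1 + t) `^ (p - 1) * c `^ (1 - p))%R.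
  rewrite -[(1 - p)%R]opprB powRN.
  rewrite [X in (_ = X * _)%R](_ : _ = t `^ (p - 1) * c `^ (p - 1))%R.
    by rewrite mulfK// gt_eqF// powR_gt0.
  by rewrite -powRM ?ltW// /c mulrCA divff ?mulr1// gt_eqF.
by rewrite ler_pM2l ?powR_gt0//; apply: ler1_powR; rewrite ?gerBl.
Qed.

End powers.

Section real_line_functions.
Variable R : realType.

Lemma measurable_fun_real_line d (T : measurableType d) (f : R -> T) :
  measurable_fun setT (f : measurableTypeR R -> T) ->
  measurable_fun (posR R) (f : real_line R -> T).
Proof.
move=> mf _ Y mY; apply: measurableI; first exact: measurable_posR.
by apply: measurable_real_line; rewrite -[X in measurable X]setTI; exact: mf.
Qed.

Lemma nondecreasing_measurable_posR (f : R -> \bar R) :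
  (forall s t : R, (0 < s)%R -> (s <= t)%R -> f s <= f t) ->
  measurable_fun (posR R) (f : real_line R -> \bar R).
Proof.
move=> nf; apply: measurable_fun_gtP => l; apply: measurable_real_line.
apply: is_interval_measurable => x y /=.
move=> [/posRE x0 lx] [/posRE y0 ly] z /andP[xz zy].
have z0 : (0 < z)%R by exact: lt_le_trans xz.
by split; [exact/posRE|exact/(lt_le_trans lx)/nf].
Qed.

Lemma measurable_powR_posR (p : R) :
  measurable_fun (posR R) (fun t => (t `^ p)%:E : \bar R).
Proof.
apply: (@measurable_fun_real_line _ _ (fun t => (t `^ p)%:E)).
by apply/measurable_EFinP; exact: measurable_powR.
Qed.

End real_line_functions.

(** * Algebraic and order properties of the rearrangement *)

Lemma eq_ereal_gt (R : realType) (a b : \bar R) : 0 <= a -> 0 <= b ->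
  (forall l : R, (0 <= l)%R -> (l%:E < a) = (l%:E < b)) -> a = b.
Proof.
move=> a0 b0 H; have [ab|ba|//] := ltgtP a b.
- have fa : a \is a fin_num by rewrite ge0_fin_numE// (lt_le_trans ab (leey _)).
  by have := H (fine a); rewrite fineK// ltxx ab fine_ge0// => /(_ isT).
- have fb : b \is a fin_num by rewrite ge0_fin_numE// (lt_le_trans ba (leey _)).
  by have := H (fine b); rewrite fineK// ltxx ba fine_ge0// => /(_ isT).
Qed.

Lemma lte_between (R : realType) (l : R) (m : \bar R) : l%:E < m ->
  exists2 s : R, (l < s)%R & s%:E < m.
Proof.
case: m => [m| |]// lm; last by exists (l + 1)%R; rewrite ?ltrDl ?ltry.
move: lm; rewrite lte_fin => lm.
by exists ((l + m) / 2)%R; rewrite ?lte_fin; lra.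
Qed.

Section rearrangement_properties.
Context d (T : measurableType d) (R : realType).
Variables (mu : {sigma_finite_measure set T -> \bar R}) (D : set T).
Hypothesis mD : measurable D.
Implicit Types (f g : T -> \bar R) (l t : R).

Lemma rearr_le f g t : measurable_fun D f -> measurable_fun D g ->
  (forall l, (0 <= l)%R -> distr mu D f l <= distr mu D g l) ->
  rearr mu D f t <= rearr mu D g t.
Proof.
move=> mf mg fg; rewrite leNgt; apply/negP => gf.
have := rearr_ge0 mu D g t; case E : (rearr mu D g t) => [l| |]//.
  rewrite lee_fin => l0; move: gf; rewrite E lt_rearrP// => H.
  have := lt_le_trans H (fg _ l0).
  by rewrite -(lt_rearrP _ _ _ mg)// E ltxx.
by move: gf; rewrite E ltNge leey.
Qed.

Lemma ae_distr_le f g l : measurable_fun D f -> measurable_fun D g ->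
  {ae mu, forall x, D x -> `|f x| <= `|g x|} ->
  distr mu D f l <= distr mu D g l.
Proof.
move=> mf mg [N [mN N0 fgN]]; rewrite /distr.
rewrite -[leRHS](measureU0 (mu := mu) _ mN N0); last exact: measurable_gt_abse.
apply: subset_measure_le => //; first exact: measurable_gt_abse.
  by apply: measurableU => //; exact: measurable_gt_abse.
move=> x [Dx /= lf]; have [Nx|Nx] := pselect (N x); first by right.
left; split => //=; apply: (lt_le_trans lf).
by move/subsetCl : fgN => /(_ _ Nx); exact.
Qed.

Lemma ae_rearr_le f g t : measurable_fun D f -> measurable_fun D g ->
  {ae mu, forall x, D x -> `|f x| <= `|g x|} ->
  rearr mu D f t <= rearr mu D g t.
Proof. by move=> mf mg fg; apply: rearr_le => // l _; exact: ae_distr_le. Qed.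

Lemma rearrZ f k t : (0 < k)%R -> measurable_fun D f ->
  rearr mu D (fun x => k%:E * f x) t = k%:E * rearr mu D f t.
Proof.
move=> k0 mf; have mkf : measurable_fun D (fun x => k%:E * f x).
  by apply: emeasurable_funM => //; exact: measurable_cst.
apply: eq_ereal_gt; rewrite ?rearr_ge0//.
  by rewrite mule_ge0 ?rearr_ge0// lee_fin ltW.
have kE (l : R) (y : \bar R) : (l%:E < k%:E * y) = ((k^-1 * l)%:E < y).
  by rewrite EFinM -lte_pdivlMl ?invr_gt0// invrK.
move=> l l0; rewrite lt_rearrP// kE lt_rearrP ?mulr_ge0 ?invr_ge0// ?(ltW k0)//.
congr (_ < mu _); apply/seteqP; split => x /= [Dx];
  by rewrite abseM/= gtr0_norm// kE.
Qed.

Lemma rearr_intZ f k t : (0 < k)%R -> measurable_fun D f ->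
  rearr_int mu D (fun x => k%:E * f x) t = k%:E * rearr_int mu D f t.
Proof.
move=> k0 mf; rewrite -(ge0_integralZl_EFin _ (measurable_itv0t t)).
- by apply: eq_integral => s _; rewrite rearrZ.
- by move=> *; exact: rearr_ge0.
- exact: measurable_rearr_itv0t.
- exact: ltW.
Qed.

Lemma rearr_int_eq0 f t : measurable_fun D f -> (0 <= t)%R ->
  {ae mu, forall x, D x -> f x = 0} -> rearr_int mu D f t = 0.
Proof.
move=> mf t0 f0; apply/eqP; rewrite eq_le rearr_int_ge0 andbT.
apply: (le_trans (rearr_int_le_integral _ mD mf t0)).
by rewrite (ae_eq_integral_abs mu mD mf).2.
Qed.

Lemma rearr_int_gt0 f s t : measurable_fun D f -> (0 < s)%R -> (s <= t)%R ->
  0 < rearr mu D f s -> 0 < rearr_int mu D f t.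
Proof.
move=> mf s0 st fs0.
apply: lt_le_trans (rearr_int_nondecreasing _ _ _ st).
have [l l0 lfs] : exists2 l : R, (0 < l)%R & l%:E <= rearr mu D f s.
  case: (rearr mu D f s) fs0 => [r| |]//.
    by rewrite lte_fin => r0; exists r.
  by exists 1%R => //; exact: leey.
apply: (@lt_le_trans _ _ (s * l)%:E); first by rewrite lte_fin mulr_gt0.
rewrite -(integral_cst_itv0t l (ltW s0)).
apply: (ge0_le_integral _ (measurable_itv0t s)).
- by move=> _ _; rewrite lee_fin ltW.
- exact: measurable_cst.
- exact: measurable_rearr_itv0t.
- move=> x /=; rewrite in_itv/= => /andP[x0 xs].
  by apply: (le_trans lfs); apply: rearr_nonincreasing; exact: ltW.
Qed.

End rearrangement_properties.

(** * The norm of the fractional average *)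

Section ri_norm_on_half_line.
Variables (R : realType) (rhob : (real_line R -> \bar R) -> \bar R).
Hypothesis rin : ri_norm (leb1 R) (posR R) rhob.
Local Notation M := (Mplus (posR R)).

Lemma ri_norm_le_pos (g h : R -> \bar R) : M g -> M h ->
  (forall t : R, (0 < t)%R -> g t <= h t) -> rhob g <= rhob h.
Proof.
move=> Mg Mh gh; apply: (ri_norm_le rin) => //.
by apply: aeW => t /posRE; exact: gh.
Qed.

Lemma ri_norm_eq_pos (g h : R -> \bar R) : M g -> M h ->
  (forall t : R, (0 < t)%R -> g t = h t) -> rhob g = rhob h.
Proof.
move=> Mg Mh gh; apply/eqP; rewrite eq_le.
by apply/andP; split; apply: ri_norm_le_pos => // t t0; rewrite gh.
Qed.

Lemma Mplus0 : M (cst 0 : R -> \bar R).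
Proof. by split => //; exact: measurable_cst. Qed.

Lemma ri_norm_0 : rhob (cst 0) = 0.
Proof. by apply/(ri_norm_eq0 rin Mplus0); exact: aeW. Qed.

End ri_norm_on_half_line.

Lemma Mplus_abs (R : realType) d (T : measurableType d) (D : set T)
    (f : T -> \bar R) : measurable_fun D f -> Mplus D (fun x => `|f x|).
Proof. by move=> mf; split => //; exact: measurable_fun_abse. Qed.

Lemma MplusZ (R : realType) d (T : measurableType d) (D : set T)
    (f : T -> \bar R) (k : R) : (0 <= k)%R -> Mplus D f ->
  Mplus D (fun x => k%:E * f x).
Proof.
move=> k0 [mf f0]; split; last by move=> x Dx; rewrite mule_ge0// f0.
by apply: emeasurable_funM => //; exact: measurable_cst.
Qed.

Section fractional_average.
Context d (T : measurableType d) (R : realType).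
Variables (mu : {sigma_finite_measure set T -> \bar R}) (D : set T).
Hypothesis mD : measurable D.
Variable alpha : R.
Implicit Types (f g : T -> \bar R) (l t : R).

(** With alpha = gamma / n this is the function g_f of the introduction. *)
Definition frac_average f (t : R) : \bar R :=
  (t `^ alpha)%:E * rearr2 mu D f t.

Lemma frac_averageE f t : (0 < t)%R ->
  frac_average f t = (t `^ (alpha - 1))%:E * rearr_int mu D f t.
Proof.
move=> t0; rewrite /frac_average /rearr2 muleA -EFinM.
by rewrite -(powR_inv1 (ltW t0)) -powRD ?(gt_eqF t0) ?implybT.
Qed.

Lemma Mplus_frac_average f : Mplus (posR R) (frac_average f).
Proof.
split; last first.
  move=> t /posRE t0; rewrite frac_averageE// mule_ge0 ?rearr_int_ge0//.
  by rewrite lee_fin powR_ge0.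
have mg : measurable_fun (posR R)
    (fun t => (t `^ (alpha - 1))%:E * rearr_int mu D f t).
  apply: emeasurable_funM; first exact: measurable_powR_posR.
  apply: nondecreasing_measurable_posR => s t _.
  exact: rearr_int_nondecreasing.
apply: eq_measurable_fun mg => t.
by rewrite inE => /posRE t0; rewrite frac_averageE.
Qed.

(** The product of t^(1 - alpha) and the fractional average is
    nondecreasing, so the fractional average cannot drop faster than that
    power. This turns a lower bound at one point s into a lower bound on an
    interval to the right of s. *)
Lemma frac_average_ge f s t : (0 < s)%R -> (s <= t)%R ->
  ((t / s) `^ (alpha - 1))%:E * frac_average f s <= frac_average f t.
Proof.
move=> s0 st; have t0 := lt_le_trans s0 st.
rewrite !frac_averageE// muleA -EFinM -powRM ?divr_ge0 ?(ltW s0) ?(ltW t0)//.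
rewrite divfK ?gt_eqF// lee_pmul2l ?lte_fin ?powR_gt0//.
exact: rearr_int_nondecreasing.
Qed.

Variable rhob : (real_line R -> \bar R) -> \bar R.
Hypothesis rin : ri_norm (leb1 R) (posR R) rhob.

Definition frac_average_norm f := rhob (frac_average f).

Lemma frac_average_norm_eq f g :
  (forall t, (0 < t)%R -> rearr mu D f t = rearr mu D g t) ->
  frac_average_norm f = frac_average_norm g.
Proof.
move=> fg; apply: (ri_norm_eq_pos rin); try exact: Mplus_frac_average.
move=> t t0; rewrite !frac_averageE//; congr (_ * _).
by apply: eq_integral => s; rewrite inE/= in_itv/= => /andP[s0 _]; exact: fg.
Qed.

Lemma frac_average_norm_le f g : measurable_fun D f -> measurable_fun D g ->
  {ae mu, forall x, D x -> `|f x| <= `|g x|} ->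
  frac_average_norm f <= frac_average_norm g.
Proof.
move=> mf mg fg; apply: (ri_norm_le_pos rin); try exact: Mplus_frac_average.
move=> t t0; rewrite !frac_averageE// lee_pmul2l ?lte_fin ?powR_gt0//.
apply: (ge0_le_integral _ (measurable_itv0t t)).
- by move=> s _; exact: rearr_ge0.
- exact: measurable_rearr_itv0t.
- exact: measurable_rearr_itv0t.
- by move=> s _; exact: ae_rearr_le.
Qed.

Lemma frac_average_normZ f l : Mplus D f -> (0 <= l)%R ->
  frac_average_norm (fun x => l%:E * f x) = l%:E * frac_average_norm f.
Proof.
move=> [mf f0]; rewrite le_eqVlt => /predU1P[<-|l0].
  rewrite mul0e -(ri_norm_0 rin); apply: (ri_norm_eq_pos rin).
  - exact: Mplus_frac_average.
  - exact: Mplus0.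
  move=> t t0; rewrite frac_averageE// rearr_int_eq0 ?mule0 ?ltW//.
    by apply: emeasurable_funM => //; exact: measurable_cst.
  by apply: aeW => x _; rewrite mul0e.
rewrite -(ri_normZ rin) ?ltW//; last exact: Mplus_frac_average.
apply: (ri_norm_eq_pos rin).
- exact: Mplus_frac_average.
- by apply: MplusZ; [exact: ltW|exact: Mplus_frac_average].
by move=> t t0; rewrite !frac_averageE// rearr_intZ// muleCA.
Qed.

Lemma frac_average_normD f g : Mplus D f -> Mplus D g ->
  frac_average_norm (fun x => f x + g x) <=
  frac_average_norm f + frac_average_norm g.
Proof.
move=> [mf f0] [mg g0].
apply: le_trans (ri_normD rin _ _); try exact: Mplus_frac_average.
have [mF F0] := Mplus_frac_average f; have [mG G0] := Mplus_frac_average g.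
apply: (ri_norm_le_pos rin); first exact: Mplus_frac_average.
  by split; [exact: emeasurable_funD|move=> t pt; rewrite adde_ge0 ?F0 ?G0].
move=> t t0; rewrite !frac_averageE// -ge0_muleDr ?rearr_int_ge0//.
rewrite lee_pmul2l ?lte_fin ?powR_gt0//.
exact: rearr_intD.
Qed.

(** If f does not vanish almost everywhere, then f*(s) > 0 for some s > 0,
    and the fractional average is positive at every t >= s. *)
Lemma frac_average_norm_eq0 f : Mplus D f ->
  (frac_average_norm f = 0 <-> {ae mu, forall x, D x -> f x = 0}).
Proof.
move=> [mf f0]; split; last first.
  move=> f00; rewrite -(ri_norm_0 rin); apply: (ri_norm_eq_pos rin).
  - exact: Mplus_frac_average.
  - exact: Mplus0.
  by move=> t t0; rewrite frac_averageE// rearr_int_eq0 ?mule0 ?ltW.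
move=> /(ri_norm_eq0 rin (Mplus_frac_average f)) [N [mN N0 fN]].
have /eqP : distr mu D f 0 = 0.
  apply: contrapT => /eqP f_neq0.
  have f_gt0 : 0 < distr mu D f 0 by rewrite lt0e f_neq0 distr_ge0.
  have [s s0 fs] : exists2 s : R, (0 < s)%R & s%:E < distr mu D f 0.
    case: (distr mu D f 0) f_gt0 => [r| |]//.
      rewrite lte_fin => r0; exists (r / 2)%R; first by rewrite divr_gt0.
      by rewrite lte_fin ltr_pdivrMr// ltr_pMr// ltr1n.
    by exists 1%R => //; exact: ltry.
  (* the fractional average is positive from s on, hence on a set of positive
     measure *)
  have : leb1 R `[s, (s + 1)%R]%classic <= leb1 R N.
    apply: subset_measure_le => //.
      by apply: measurable_real_line; exact: measurable_itv.
    move=> t /=; rewrite in_itv/= => /andP[st _]; apply: fN => /= H.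
    have t0 := lt_le_trans s0 st.
    have := H ((posRE _).2 t0); rewrite frac_averageE// => /eqP.
    rewrite mule_eq0 eqe gt_eqF ?powR_gt0//= gt_eqF//.
    by apply: rearr_int_gt0 st _ => //; rewrite lt_rearrP.
  rewrite [leRHS]N0 leb1_lebesgue_measure lebesgue_measure_itv/= lte_fin.
  rewrite ltrDl ltr01.
  by rewrite -EFinB lee_fin addrAC subrr add0r ler10.
rewrite /distr => /eqP f00; exists (D `&` [set x | 0 < `|f x|]); split => //.
  exact: measurable_gt_abse.
move=> x /= /not_implyP[Dx fx]; split => //=.
by rewrite lt0e abse_ge0 andbT abse_eq0; exact/eqP.
Qed.

End fractional_average.

(** * Idempotence and monotone limits of rearrangements *)

Lemma rearr_abs d (T : measurableType d) (R : realType)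
    (mu : {measure set T -> \bar R}) (D : set T) (f : T -> \bar R) t :
  rearr mu D (fun x => `|f x|) t = rearr mu D f t.
Proof.
have absE (l : R) :
    [set x | l%:E < abse (abse (f x))] = [set x | l%:E < abse (f x)].
  by apply/seteqP; split => x /=; rewrite abse_id.
by congr ereal_inf; apply/seteqP; split => _ [l [l0 lt_] <-]; exists l => //;
  split => //; move: lt_; rewrite absE.
Qed.

(** A function and its rearrangement are equimeasurable, so rearranging
    twice changes nothing. *)
Lemma rearr_rearr d (T : measurableType d) (R : realType)
    (mu : {sigma_finite_measure set T -> \bar R}) (D : set T)
    (f : T -> \bar R) t : measurable D -> measurable_fun D f ->
  rearr (leb1 R) (posR R) (rearr mu D f) t = rearr mu D f t.
Proof.
move=> mD mf; apply: eq_ereal_gt; try exact: rearr_ge0.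
move=> l l0; rewrite !lt_rearrP//; last 2 first.
- exact: measurable_posR.
- exact: measurable_rearr.
rewrite -(distr_rearr mu mD mf l0); congr (_ < leb1 R _).
by apply/seteqP; split => s /= [ps]; rewrite gee0_abs ?rearr_ge0.
Qed.

Lemma nondecreasing_cvg_approx (R : realType) (u : (\bar R)^nat) (x : \bar R) :
  nondecreasing_seq u -> (forall k, 0 <= u k) -> (forall k, u k <= x) ->
  (forall l : R, (0 <= l)%R -> l%:E < x -> exists k, l%:E < u k) ->
  u @ \oo --> x.
Proof.
move=> ndu u0 ux H; rewrite (_ : x = ereal_sup (range u)).
  exact: ereal_nondecreasing_cvgn.
apply: eq_ereal_gt.
- exact: le_trans (u0 0%N) (ux 0%N).
- by apply: le_trans (u0 0%N) _; apply: ereal_sup_ubound; exists 0%N.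
move=> l l0; apply/idP/idP => [/H|].
  move=> /(_ l0)[k luk]; apply: (lt_le_trans luk).
  by apply: ereal_sup_ubound; exists k.
move=> /lt_le_trans; apply; apply: ge_ereal_sup => _ [k _ <-]; exact: ux.
Qed.

Lemma nondecreasing_le_cvg (R : realType) (u : (\bar R)^nat) (x : \bar R) k :
  nondecreasing_seq u -> u @ \oo --> x -> u k <= x.
Proof.
move=> ndu ux; rewrite -(cvg_lim _ ux)//.
rewrite (cvg_lim _ (ereal_nondecreasing_cvgn ndu))//.
by apply: ereal_sup_ubound; exists k.
Qed.

Section rearrangement_monotone_limits.
Context d (T : measurableType d) (R : realType).
Variables (mu : {sigma_finite_measure set T -> \bar R}) (D : set T).
Hypothesis mD : measurable D.
Variables (F : (T -> \bar R)^nat) (f : T -> \bar R).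
Hypotheses (MF : forall j, Mplus D (F j)) (Mf : Mplus D f).
Hypothesis Ff : {ae mu, forall x, D x ->
  nondecreasing_seq (F ^~ x) /\ F ^~ x @ \oo --> f x}.

Let ae_le j : {ae mu, forall x, D x -> `|F j x| <= `|f x|}.
Proof.
apply: filterS Ff => x H Dx; have [ndF cF] := H Dx.
rewrite !gee0_abs ?(MF j).2 ?Mf.2//.
exact: (nondecreasing_le_cvg j ndF cF).
Qed.

Let ae_nd j k : (j <= k)%N -> {ae mu, forall x, D x -> `|F j x| <= `|F k x|}.
Proof.
move=> jk; apply: filterS Ff => x H Dx; have [ndF _] := H Dx.
by rewrite !gee0_abs ?(MF j).2 ?(MF k).2//; exact: ndF.
Qed.

Lemma rearr_nondecreasing_seq t :
  nondecreasing_seq (fun j => rearr mu D (F j) t).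
Proof.
move=> j k jk; apply: ae_rearr_le => //; [exact: (MF j).1|exact: (MF k).1|].
exact: ae_nd.
Qed.

(** By [lt_rearrP] it is enough that the level sets of the F j exhaust the
    level set of f in measure, and they increase to it outside of a null
    set. *)
Lemma cvg_rearr t : rearr mu D (F j) t @[j --> \oo] --> rearr mu D f t.
Proof.
apply: nondecreasing_cvg_approx.
- exact: rearr_nondecreasing_seq.
- by move=> k; exact: rearr_ge0.
- move=> k; apply: ae_rearr_le => //; [exact: (MF k).1|exact: Mf.1].
move=> l l0; rewrite lt_rearrP//; last exact: Mf.1.
have [N [mN N0 fN]] := Ff.
rewrite /distr => H.
have {}H : t%:E < mu ((D `&` [set x | l%:E < `|f x|]) `\` N).
  apply: (lt_le_trans H).
  rewrite -[leRHS](measureU0 (mu := mu) _ mN N0); last first.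
    by apply: measurableD => //; apply: measurable_gt_abse => //; exact: Mf.1.
  apply: subset_measure_le.
  - by apply: measurable_gt_abse => //; exact: Mf.1.
  - apply: measurableU => //; apply: measurableD => //.
    by apply: measurable_gt_abse => //; exact: Mf.1.
  - by move=> x xf; have [Nx|Nx] := pselect (N x); [right|left; split].
have mB j : measurable ((D `&` [set x | l%:E < `|F j x|]) `\` N).
  by apply: measurableD => //; apply: measurable_gt_abse => //; exact: (MF j).1.
have fN' x : D x -> ~ N x -> nondecreasing_seq (F ^~ x) /\ F ^~ x @ \oo --> f x.
  by move=> Dx Nx; move/subsetCl : fN => /(_ _ Nx); exact.
have ndB : nondecreasing_seq (fun j => (D `&` [set x | l%:E < `|F j x|]) `\` N).
  move=> j k jk; apply/subsetPset => x [[Dx /= lFj] Nx].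
  split => //; split => //=.
  have [ndF _] := fN' _ Dx Nx; apply: (lt_le_trans lFj).
  by rewrite !gee0_abs ?(MF j).2 ?(MF k).2//; exact: ndF.
suff BE : \bigcup_k ((D `&` [set x | l%:E < `|F k x|]) `\` N) =
    (D `&` [set x | l%:E < `|f x|]) `\` N.
  move: H; rewrite -BE => /(lt_measure_bigcup mB ndB)[k tk].
  exists k; rewrite lt_rearrP//; last exact: (MF k).1.
  apply: (lt_le_trans tk); apply: subset_measure_le => //.
    by apply: measurable_gt_abse => //; exact: (MF k).1.
apply/seteqP; split=> [x [k _ [[Dx /= lFk] Nx]]|x [[Dx /= lf] Nx]].
  split => //; split => //=; apply: (lt_le_trans lFk).
  have [ndF cF] := fN' _ Dx Nx.
  rewrite !gee0_abs ?(MF k).2 ?Mf.2//.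
  exact: (nondecreasing_le_cvg k ndF cF).
have [ndF cF] := fN' _ Dx Nx; apply: contrapT => nF.
have : f x <= l%:E.
  rewrite -(cvg_lim _ cF)//; apply: lime_le; first exact: cvgP cF.
  apply: nearW => k; rewrite leNgt; apply/negP => lFk; apply: nF.
  by exists k => //; split => //; split => //=; rewrite gee0_abs// (MF k).2.
by rewrite leNgt -(gee0_abs (Mf.2 _ Dx)) lf.
Qed.

Lemma cvg_rearr_int t :
  rearr_int mu D (F j) t @[j --> \oo] --> rearr_int mu D f t.
Proof.
rewrite (_ : rearr_int mu D f t =
    \int[leb1 R]_(s in `]0%R, t[) limn (fun j => rearr mu D (F j) s)).
  apply: (cvg_monotone_convergence (measurable_itv0t t)).
  - by move=> j; exact: measurable_rearr_itv0t.
  - by move=> j s _; exact: rearr_ge0.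
  - by move=> s _; exact: rearr_nondecreasing_seq.
by apply: eq_integral => s _; apply/esym/cvg_lim => //; exact: cvg_rearr.
Qed.

End rearrangement_monotone_limits.

(** * The fractional average defines an r.i. norm *)

Lemma Mplus_shifted_power (R : realType) (p : R) :
  Mplus (posR R) (fun t => ((1 + t) `^ p)%:E : \bar R).
Proof.
split; last by move=> t _; rewrite lee_fin powR_ge0.
apply: (@measurable_fun_real_line _ _ _ (fun t => ((1 + t) `^ p)%:E)).
apply/measurable_EFinP.
apply: (@measurableT_comp _ _ _ _ _ _ (@powR R ^~ p)).
  exact: measurable_powR.
by apply: measurable_funD; [exact: measurable_cst|exact: measurable_id].
Qed.

Section fractional_average_norm.
Context d (T : measurableType d) (R : realType).
Variables (mu : {sigma_finite_measure set T -> \bar R}) (D : set T).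
Hypothesis mD : measurable D.
Variable alpha : R.
Hypothesis alpha01 : (0 <= alpha <= 1)%R.
Variable rhob : (real_line R -> \bar R) -> \bar R.
Hypothesis rin : ri_norm (leb1 R) (posR R) rhob.

Lemma frac_average_norm_fatou (F : (T -> \bar R)^nat) f :
  (forall j, Mplus D (F j)) -> Mplus D f ->
  {ae mu, forall x, D x ->
    nondecreasing_seq (fun j => F j x) /\ F j x @[j --> \oo] --> f x} ->
  nondecreasing_seq (fun j => frac_average_norm mu D alpha rhob (F j)) /\
  frac_average_norm mu D alpha rhob (F j) @[j --> \oo] -->
  frac_average_norm mu D alpha rhob f.
Proof.
move=> MF Mf Ff; apply: (ri_norm_fatou rin).
- by move=> j; exact: Mplus_frac_average.
- exact: Mplus_frac_average.
apply: aeW => t /posRE t0; split.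
  move=> j k jk; rewrite !frac_averageE// lee_pmul2l ?lte_fin ?powR_gt0//.
  apply: (ge0_le_integral _ (measurable_itv0t t)).
  - by move=> s _; exact: rearr_ge0.
  - exact: measurable_rearr_itv0t.
  - exact: measurable_rearr_itv0t.
  - by move=> s _; exact: (rearr_nondecreasing_seq mD MF Ff).
rewrite frac_averageE// (_ : (fun j => _) =
    (fun j => (t `^ (alpha - 1))%:E * rearr_int mu D (F j) t)).
  by apply: cvgeZl => //; exact: cvg_rearr_int.
by apply/funext => j; rewrite frac_averageE.
Qed.

(** For f = 1_E the integral of f* over (0, t) is at most both t and |E|, so
    t^alpha f**(t) is at most (1 + |E|) (1 + t)^(alpha - 1). This is the
    axiom that forces the hypothesis on the norm. *)
Lemma frac_average_norm_indic (E : set T) :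
  rhob (fun t => ((1 + t) `^ (alpha - 1))%:E) < +oo ->
  measurable E -> E `<=` D -> mu E < +oo ->
  frac_average_norm mu D alpha rhob (fun x => (\1_E x)%:E) < +oo.
Proof.
move=> psi_fin mE ED Efin; pose m := fine (mu E).
have Em : mu E = m%:E by rewrite fineK// ge0_fin_numE// measure_ge0.
have m0 : (0 <= m)%R by rewrite fine_ge0.
have mpsi := Mplus_shifted_power (alpha - 1).
have m10 : (0 <= 1 + m)%R by rewrite addr_ge0.
apply: (@le_lt_trans _ _
    ((1 + m)%:E * rhob (fun t => ((1 + t) `^ (alpha - 1))%:E))); last first.
  by rewrite lte_mul_pinfty ?lee_fin.
rewrite -(ri_normZ rin)//; apply: (ri_norm_le_pos rin).
- exact: Mplus_frac_average.
- exact: MplusZ.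
have mI : measurable_fun D (fun x => (\1_E x)%:E : \bar R).
  by apply/measurable_EFinP; exact: measurable_indic.
move=> t t0; rewrite frac_averageE//.
have I1 : rearr_int mu D (fun x => (\1_E x)%:E) t <= t%:E.
  have := rearr_int_le mu mD mI (@ler01 R) (ltW t0); rewrite mulr1.
  move=> /le_trans; apply; rewrite /excess integral0_eq ?adde0// => x _.
  by rewrite truncate0// lee_fin ger0_norm ?indicE ?lern1 ?leq_b1.
have I2 : rearr_int mu D (fun x => (\1_E x)%:E) t <= m%:E.
  apply: (le_trans (rearr_int_le_integral mu mD mI (ltW t0))).
  under eq_integral do rewrite gee0_abs ?lee_fin//.
  by rewrite integral_indic// -Em setIidl.
have := rearr_int_ge0 mu D (fun x => (\1_E x)%:E) t.
move: I1 I2; case: (rearr_int _ _ _ _) => [r| |]//.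
rewrite !lee_fin => rt rm r0; rewrite -?EFinM ?lee_fin.
apply: (@le_trans _ _ ((1 + t) `^ (alpha - 1) * ((1 + t) / t) * r)%R).
  by rewrite ler_wpM2r// powRB1_le.
rewrite -mulrA [leRHS]mulrC ler_wpM2l ?powR_ge0//.
rewrite mulrAC ler_pdivrMr// !mulrDl !mul1r addrC [leRHS]addrC.
by rewrite lerD// mulrC ler_wpM2r// ltW.
Qed.

(** With a = |E| + 1, the fractional average is at least (2a)^(alpha - 1) a
    f**(a) on the whole interval [a, 2a], and a f**(a) dominates the
    integral over E. The constant therefore comes from the same axiom for
    rhob on [a, 2a]. *)
Lemma integral_le_frac_average_norm (E : set T) :
  measurable E -> E `<=` D -> mu E < +oo ->
  exists2 C : R, (0 < C)%R & forall f, Mplus D f ->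
    \int[mu]_(x in E) f x <= C%:E * frac_average_norm mu D alpha rhob f.
Proof.
move=> mE ED Efin; pose a := (fine (mu E) + 1)%R.
have a0 : (0 < a)%R by rewrite ltr_wpDl// fine_ge0.
have Ea : mu E <= a%:E.
  by rewrite EFinD fineK ?ge0_fin_numE ?measure_ge0// leeDl.
pose J := `[a, (a + a)%R]%classic.
have mJ : measurable (J : set (real_line R)).
  by apply: measurable_real_line; exact: measurable_itv.
have JD : J `<=` posR R.
  move=> t; rewrite /J/= in_itv/= => /andP[at_ _]; apply/posRE.
  exact: lt_le_trans at_.
have muJ : leb1 R J = a%:E.
  rewrite leb1_lebesgue_measure /J lebesgue_measure_itv/= lte_fin ltrDl a0.
  by rewrite -EFinB addrK.
have muJfin : leb1 R J < +oo by rewrite muJ ltry.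
have [C C0 HC] := ri_norm_int rin mJ JD muJfin.
pose k := ((a + a) `^ (alpha - 1) * a)%R.
have k0 : (0 < k)%R by rewrite mulr_gt0// powR_gt0// addr_gt0.
exists (k^-1 * C)%R; first by rewrite mulr_gt0// invr_gt0.
move=> f [mf f0]; rewrite EFinM -muleA lee_pdivlMl//.
apply: le_trans (HC _ (Mplus_frac_average mu D alpha f)).
have [mG G0] := Mplus_frac_average mu D alpha f.
apply: (@le_trans _ _ (\int[leb1 R]_(t in J)
    (((a + a) `^ (alpha - 1))%:E * rearr_int mu D f a))).
  rewrite (integral_cst _ mJ) [X in _ <= _ * X]muJ.
  rewrite muleAC -EFinM lee_pmul2l ?lte_fin//.
  apply: le_trans (hardy_littlewood mD mf mE ED Ea a0).
  apply: ge0_le_integral => //.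
  - by move=> x Ex; exact/f0/ED.
  - exact: measurable_funS mf.
  - exact/(measurable_funS mD ED)/measurable_fun_abse.
  - by move=> x _; rewrite lee_abs.
apply: (ge0_le_integral _ mJ).
- by move=> _ _; rewrite mule_ge0 ?rearr_int_ge0// lee_fin powR_ge0.
- exact: measurable_cst.
- by apply: measurable_funS mG; [exact: measurable_posR|exact: JD].
- move=> t Jt; have /posRE t0 := JD _ Jt; move: Jt.
  rewrite /J/= in_itv/= => /andP[at_ ta]; rewrite frac_averageE//.
  apply: lee_pmul.
  + by rewrite lee_fin powR_ge0.
  + exact: rearr_int_ge0.
  + rewrite lee_fin ler_powR_npos// subr_le0.
    by case/andP: alpha01.
  + exact: rearr_int_nondecreasing.
Qed.

Lemma ri_norm_frac_average :
  rhob (fun t => ((1 + t) `^ (alpha - 1))%:E) < +oo ->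
  ri_norm mu D (frac_average_norm mu D alpha rhob).
Proof.
move=> psi_fin; split.
- by move=> f _; apply: (ri_norm_ge0 rin); exact: Mplus_frac_average.
- by move=> f; exact: frac_average_norm_eq0.
- by move=> f l; exact: frac_average_normZ.
- by move=> f g; exact: frac_average_normD.
- move=> f g [mf f0] [mg g0] fg; apply: frac_average_norm_le => //.
  by apply: filterS fg => x H Dx; rewrite !gee0_abs ?f0 ?g0//; exact: H.
- exact: frac_average_norm_fatou.
- by move=> E mE ED Efin; exact: frac_average_norm_indic.
- exact: integral_le_frac_average_norm.
- by move=> f g _ _; exact: frac_average_norm_eq.
Qed.

End fractional_average_norm.

(** * A covering lemma for cubes *)

Section cubes.
Variables (R : realType) (n : nat).
Implicit Types (a : n.-tuple R) (l t : R).

Lemma cube_box a l : cube a l = box a [tuple (tnth a i + l)%R | i < n].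
Proof.
by apply/seteqP; split => x H i; have := H i; rewrite tnth_mktuple.
Qed.

Lemma measurable_cube a l : measurable (cube a l).
Proof.
rewrite cube_box; apply: sub_caratheodory; apply: sub_sigma_algebra.
exact: measurable_box.
Qed.

Lemma lebn_cube a l : (0 <= l)%R -> lebn R n (cube a l) = (l ^+ n)%:E.
Proof.
move=> l0; rewrite cube_box lebn_box; last first.
  by move=> i; rewrite tnth_mktuple lerDl.
congr EFin; rewrite -[in RHS](card_ord n) -prodr_const.
by apply: eq_bigr => i _; rewrite tnth_mktuple addrAC subrr add0r.
Qed.

(** Cubes are given by their lower corner and their edge, so the concentric
    cube of three times the edge starts one edge lower. *)
Definition triple_cube (c : n.-tuple R * R) : set (euclidean R n) :=
  cube [tuple (tnth c.1 i - c.2)%R | i < n] (3 * c.2).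

Lemma sub_triple_cube (c c' : n.-tuple R * R) : (c'.2 <= c.2)%R ->
  cube c.1 c.2 `&` cube c'.1 c'.2 !=set0 ->
  cube c'.1 c'.2 `<=` triple_cube c.
Proof.
move=> c'c [y [cy c'y]] x c'x i; rewrite tnth_mktuple.
have /andP[? ?] := cy i; have /andP[? ?] := c'y i; have /andP[? ?] := c'x i.
by apply/andP; split; lra.
Qed.

Definition disjoint_cubes (c c' : n.-tuple R * R) : bool :=
  `[< cube c.1 c.2 `&` cube c'.1 c'.2 = set0 >].

Lemma exists_largest (s : seq (n.-tuple R * R)) : s != [::] ->
  exists2 c, c \in s & forall c', c' \in s -> (c'.2 <= c.2)%R.
Proof.
elim: s => // c s IH _; have [->|/IH[d ds dmax]] := eqVneq s [::].
  by exists c; rewrite ?mem_head// => c'; rewrite mem_seq1 => /eqP ->.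
have [cd|dc] := leP c.2 d.2.
  exists d; first by rewrite in_cons ds orbT.
  by move=> c'; rewrite in_cons => /predU1P[->//|]; exact: dmax.
exists c; first by rewrite mem_head.
move=> c'; rewrite in_cons => /predU1P[->//|/dmax c'd].
exact: le_trans c'd (ltW dc).
Qed.

(** Greedy selection: a largest cube is kept, the cubes that meet it lie in
    its triple and are discarded, and the selection is repeated on the cubes
    disjoint from it. *)
Lemma vitali_cubes (s : seq (n.-tuple R * R)) :
  (forall c, c \in s -> (0 < c.2)%R) ->
  exists s' : seq (n.-tuple R * R), [/\ {subset s' <= s},
    pairwise disjoint_cubes s' &
    forall c, c \in s -> exists2 c', c' \in s' &
      cube c.1 c.2 `<=` triple_cube c'].
Proof.
have [k] := ubnP (size s); elim: k s => // k IH s sk s0.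
have [->|/exists_largest[c cs cmax]] := eqVneq s [::].
  by exists [::]; split => // ? /[!in_nil].
pose s1 := [seq d <- s | disjoint_cubes c d].
have s1s : {subset s1 <= s} by move=> d; rewrite mem_filter => /andP[].
(* c contains its own corner, so it is not in s1 and the recursion ends *)
have ncc : ~~ disjoint_cubes c c.
  apply/asboolPn; rewrite setIid => c0.
  have : cube c.1 c.2 c.1 by move=> i; rewrite lexx/= lerDl ltW// s0.
  by rewrite c0.
have s1k : (size s1 < k)%N.
  rewrite -ltnS (leq_trans _ sk)// ltnS size_filter.
  rewrite -(count_predC (disjoint_cubes c)) -addn1 leq_add2l -has_count.
  by apply/hasP; exists c.
have [|s' [s's1 ds' s'cover]] := IH _ s1k; first by move=> d /s1s /s0.
exists (c :: s'); split.
- move=> d; rewrite in_cons => /predU1P[->//|/s's1]; exact: s1s.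
- rewrite /= ds' andbT; apply/allP => d /s's1.
  by rewrite mem_filter => /andP[].
- move=> d ds; have [dd|/asboolPn/eqP/set0P dd] := boolP (disjoint_cubes c d).
    have [|e es' de] := s'cover d; first by rewrite mem_filter dd.
    by exists e => //; rewrite in_cons es' orbT.
  exists c; first by rewrite mem_head.
  by apply: sub_triple_cube => //; exact: cmax.
Qed.

End cubes.

Section finite_unions.
Context d (T : measurableType d) (R : realType) (I : choiceType).
Variables (mu : {measure set T -> \bar R}) (A : I -> set T).
Hypothesis mA : forall i, measurable (A i).
Implicit Type s : seq I.

Lemma measurable_bigsetU s : measurable (\big[setU/set0]_(i <- s) A i).
Proof. exact: bigsetU_measurable. Qed.

Lemma measure_bigsetU_le s :
  mu (\big[setU/set0]_(i <- s) A i) <= \sum_(i <- s) mu (A i).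
Proof.
elim: s => [|i s IH]; first by rewrite !big_nil measure0.
rewrite !big_cons (le_trans (measureU2 _ _ _))//; last exact: leeD2l.
exact: measurable_bigsetU.
Qed.

Lemma integral_bigsetU_disjoint s (f : T -> \bar R) : measurable_fun setT f ->
  (forall x, 0 <= f x) -> pairwise (fun i j => `[< A i `&` A j = set0 >]) s ->
  \int[mu]_(x in \big[setU/set0]_(i <- s) A i) f x =
  \sum_(i <- s) \int[mu]_(x in A i) f x.
Proof.
move=> mf f0; elim: s => [|i s IH]; first by rewrite !big_nil integral_set0.
rewrite pairwise_cons => /andP[/allP dis /IH {}IH]; rewrite !big_cons -IH.
rewrite ge0_integral_setU//.
- exact: measurable_bigsetU.
- exact: measurable_funTS.
- apply/disj_setPS => x [Aix]; rewrite -bigcup_seq => -[j /= js Ajx].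
  have /asboolP ij0 := dis j js.
  by have : (A i `&` A j) x by []; rewrite ij0.
Qed.

End finite_unions.

Section power_subadditivity.
Variable R : realType.
Implicit Types (x y p : R).

Lemma powRD_le x y p : (0 < p <= 1)%R -> (0 < x)%R -> (0 < y)%R ->
  ((x + y) `^ p <= x `^ p + y `^ p)%R.
Proof.
move=> /andP[p0 p1] x0 y0; have xy0 : (0 < x + y)%R by rewrite addr_gt0.
have p10 : (p - 1 <= 0)%R by rewrite subr_le0.
rewrite -(mulr_powRB1 (ltW xy0) p0) -(mulr_powRB1 (ltW x0) p0).
rewrite -(mulr_powRB1 (ltW y0) p0) mulrDl lerD// ler_pM2l// ler_powR_npos//.
  by rewrite lerDl ltW.
by rewrite lerDr ltW.
Qed.

(** Applied to the volumes of disjoint cubes with p = 1 - alpha, this turns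
    a lower bound on each cube into one in terms of the total volume. *)
Lemma powR_sum_le (I : eqType) (s : seq I) (x : I -> R) p : (0 < p <= 1)%R ->
  (forall i, i \in s -> (0 < x i)%R) ->
  ((\sum_(i <- s) x i) `^ p <= \sum_(i <- s) x i `^ p)%R.
Proof.
move=> p01; have /andP[p0 p1] := p01.
elim: s => [|i s IH] x0; first by rewrite !big_nil powR0// gt_eqF.
have xs j : j \in s -> (0 < x j)%R.
  by move=> js; apply: x0; rewrite in_cons js orbT.
have [s0|s0] := eqVneq s [::]; first by rewrite s0 !big_seq1.
rewrite !big_cons; apply: le_trans (powRD_le p01 _ _) _.
- by apply: x0; rewrite mem_head.
- case: s s0 {IH x0} xs => // j s _ xs.
  rewrite big_cons ltr_wpDr ?xs ?mem_head//.
  by rewrite big_seq sumr_ge0// => k ks; rewrite ltW// xs// in_cons ks orbT.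
- by rewrite lerD2l IH.
Qed.

End power_subadditivity.

(** * Level sets of the fractional maximal function *)

Section fractional_maximal.
Variables (R : realType) (n : nat) (gamma : R).
Hypothesis gamma_n : (0 < gamma < n%:R)%R.
Local Notation alpha := (gamma / n%:R)%R.
Local Notation ER := (euclidean R n).
Local Notation mu := (lebn R n).
Implicit Types (f : ER -> \bar R) (a : n.-tuple R) (l m t : R).

Lemma dim_gt0 : (0 < n)%N.
Proof. by case/andP: gamma_n => g0 /(lt_trans g0); rewrite ltr0n. Qed.

Lemma exponent_gt0_lt1 : (0 < alpha < 1)%R.
Proof.
case/andP: gamma_n => g0 gn.
have n0 : (0 < n%:R :> R)%R by rewrite ltr0n dim_gt0.
by rewrite divr_gt0//= ltr_pdivrMr// mul1r.
Qed.

Lemma exponent_ge0_le1 : (0 <= alpha <= 1)%R.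
Proof. by have /andP[? ?] := exponent_gt0_lt1; rewrite !ltW. Qed.

(** The quantity whose supremum over the cubes containing a point is the
    fractional maximal function there; a cube of edge l has volume l^n. *)
Definition cube_average f (c : n.-tuple R * R) : \bar R :=
  ((c.2 ^+ n) `^ (alpha - 1))%:E * \int[mu]_(y in cube c.1 c.2) `|f y|.

Lemma lt_frac_maximalP f x (m : \bar R) :
  m < frac_maximal gamma f x <->
  exists c : n.-tuple R * R,
    [/\ (0 < c.2)%R, cube c.1 c.2 x & m < cube_average f c].
Proof.
have avgE a l : (0 < l)%R -> cube_average f (a, l) =
    ((fine (mu (cube a l)) `^ (1 - alpha))^-1)%:E *
    \int[mu]_(y in cube a l) `|f y|.
  by move=> l0; rewrite lebn_cube ?ltW//= /cube_average -powRN opprB.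
split=> [/ereal_sup_gt[_ [Q [a [l [l0 QE Qx]]] <-]]|[[a l] [l0 xc mc]]].
  by rewrite QE -avgE// => mc; exists (a, l); split => //=; rewrite -QE.
apply: (lt_le_trans mc); apply: ereal_sup_ubound; exists (cube a l).
  by exists a, l.
by rewrite avgE.
Qed.

Lemma cube_average_ge0 f c : 0 <= cube_average f c.
Proof. by rewrite mule_ge0 ?lee_fin ?powR_ge0// integral_ge0. Qed.

Lemma measurable_abs_on_cube f c : measurable_fun setT f ->
  measurable_fun (cube c.1 c.2) (fun x => `|f x|).
Proof.
move=> mf; apply: measurable_funTS.
exact: measurable_fun_abse.
Qed.

(** The normalizing power of the volume depends continuously on the edge, so
    a strict inequality leaves room for a larger edge. *)
Lemma lt_cube_average_enlarge f (c : n.-tuple R * R) m : (0 < c.2)%R ->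
  m%:E < cube_average f c ->
  exists2 L, (c.2 < L)%R & forall l, (c.2 < l < L)%R ->
    m%:E < ((l ^+ n) `^ (alpha - 1))%:E * \int[mu]_(y in cube c.1 c.2) `|f y|.
Proof.
case: c => a l0 /= l00 mA.
have [m0|m0] := ltP m 0%R.
  exists (l0 + 1)%R => [|l _]; first by rewrite ltrDl.
  apply: (@lt_le_trans _ _ 0); first by rewrite lte_fin.
  by rewrite mule_ge0 ?lee_fin ?powR_ge0// integral_ge0.
(* K is the loss in the normalizing power that the strict inequality can
   absorb; dividing by m + 1 instead of m covers m = 0 *)
have [K K1 mK] : exists2 K : R, (1 < K)%R & (m * K)%:E < cube_average f (a, l0).
  case: (cube_average f (a, l0)) mA => [r| |]//.
    rewrite lte_fin => mr; exists (1 + (r - m) / (2 * (m + 1)))%R.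
      by rewrite ltrDl divr_gt0 ?subr_gt0// mulr_gt0// ltr_wpDl.
    rewrite lte_fin mulrDr mulr1 -ltrBrDl mulrA ltr_pdivrMr; first by nra.
    by rewrite mulr_gt0// ltr_wpDl.
  by exists 2%R; rewrite ?ltr1n ?ltry.
have K0 : (0 < K)%R by rewrite (lt_trans ltr01).
have n0 : (n%:R != 0 :> R)%R by rewrite pnatr_eq0 -lt0n dim_gt0.
(* enlarging the edge up to L multiplies the volume by at most K *)
pose L := (l0 * K `^ (n%:R^-1))%R.
have Ln : (L ^+ n = l0 ^+ n * K)%R.
  rewrite exprMn; congr (_ * _)%R.
  by rewrite -powR_mulrn ?powR_ge0// -powRrM mulVf// powRr1// ltW.
have LL : (l0 < L)%R.
  rewrite -[ltLHS]mulr1 ltr_pM2l//.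
  have ni0 : (0 < n%:R^-1 :> R)%R by rewrite invr_gt0 ltr0n dim_gt0.
  have := @gt0_ltr_powR R _ ni0 1%R K; rewrite !nnegrE ler01 (ltW K0) K1 powR1.
  exact.
exists L => // l /andP[l0l lL].
have l_gt0 : (0 < l)%R by exact: lt_trans l0l.
have : m%:E < (K^-1)%:E * cube_average f (a, l0).
  by rewrite lte_pdivlMl// -EFinM mulrC.
move=> /lt_le_trans; apply; rewrite /cube_average/= muleA -EFinM.
rewrite lee_wpmul2r ?integral_ge0// lee_fin.
apply: (@le_trans _ _ ((L ^+ n) `^ (alpha - 1))%R); last first.
  apply: ler_powR_npos; first by rewrite subr_le0; case/andP: exponent_ge0_le1.
    by rewrite exprn_gt0.
  have L0 := lt_trans l_gt0 lL.
  by apply: lerXn2r; rewrite ?nnegrE; exact: ltW.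
have l0n : (0 < l0 ^+ n)%R by rewrite exprn_gt0.
rewrite Ln (powRM _ (ltW l0n) (ltW K0)) mulrC ler_pM2l ?powR_gt0//.
rewrite -(powR_inv1 (ltW K0)); apply: ler_powR; first exact: ltW.
by rewrite lerBrDr addrC subrr; case/andP: exponent_ge0_le1.
Qed.

Definition rational_cube (c : n.-tuple rat * rat) : n.-tuple R * R :=
  (map_tuple ratr c.1, ratr c.2).

(** Consequently countably many cubes suffice to compute the fractional
    maximal function. *)
Lemma rational_cube_enlarge f (c : n.-tuple R * R) m : measurable_fun setT f ->
  (0 < c.2)%R -> m%:E < cube_average f c ->
  exists q, [/\ (0 < (rational_cube q).2)%R,
    cube c.1 c.2 `<=` cube (rational_cube q).1 (rational_cube q).2 &
    m%:E < cube_average f (rational_cube q)].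
Proof.
move=> mf c0 mc; have [L cL HL] := lt_cube_average_enlarge c0 mc.
pose e := ((L - c.2) / 2)%R.
have e0 : (0 < e)%R by rewrite divr_gt0// subr_gt0.
have /rat_in_itvoo[p] : (c.2 + e < L)%R by rewrite /e; lra.
rewrite in_itv/= => /andP[ep pL].
have q_ (i : 'I_n) : exists q : rat, (tnth c.1 i - e < ratr q < tnth c.1 i)%R.
  have /rat_in_itvoo[q] : (tnth c.1 i - e < tnth c.1 i)%R.
    by rewrite ltrBlDr ltrDl.
  by rewrite in_itv/= => qi; exists q.
have [q Hq] := choice q_.
exists ([tuple q i | i < n], p).
have p0 : (0 < ratr p :> R)%R by rewrite (lt_trans _ ep)// addr_gt0.
have sub : cube c.1 c.2 `<=`
    cube (rational_cube ([tuple q i | i < n], p)).1 (ratr p).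
  move=> x cx i; rewrite tnth_map tnth_mktuple.
  have /andP[? ?] := Hq i; have /andP[? ?] := cx i.
  by apply/andP; split; lra.
split => //.
have /HL mI : (c.2 < ratr p < L)%R by rewrite pL andbT (lt_trans _ ep)// ltrDl.
apply: (lt_le_trans mI); rewrite lee_wpmul2l ?lee_fin ?powR_ge0//.
apply: ge0_subset_integral => //; try exact: measurable_cube.
exact: (@measurable_abs_on_cube f (rational_cube ([tuple q i | i < n], p)) mf).
Qed.

(** The rational cubes are enumerated, and cut off at K, because the covering
    lemma selects from a finite list. *)
Definition large_cubes f m (K : nat) : seq (n.-tuple R * R) :=
  pmap (fun k => if unpickle k is Some q then
      if (0 < (rational_cube q).2)%R &&
        (m%:E < cube_average f (rational_cube q))
      then Some (rational_cube q) else None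
    else None) (iota 0 K).

Lemma large_cubesP f m K c : c \in large_cubes f m K ->
  (0 < c.2)%R /\ m%:E < cube_average f c.
Proof.
rewrite mem_pmap => /mapP[k _]; case: unpickle => // q.
by case: ifPn => // /andP[q0 mq] [->].
Qed.

Lemma sub_large_cubes f m K K' : (K <= K')%N ->
  {subset large_cubes f m K <= large_cubes f m K'}.
Proof.
move=> KK' c; rewrite !mem_pmap => /mapP[k kK ->]; apply: map_f.
by move: kK; rewrite !mem_iota !add0n /= => /leq_trans; apply.
Qed.

(** Besides measurability, this gives an exhaustion of the level sets by
    finite unions of cubes, which replaces compact exhaustion in the
    covering argument. *)
Lemma lt_frac_maximal_bigcup f m : measurable_fun setT f ->
  [set x | m%:E < frac_maximal gamma f x] =
  \bigcup_K \big[setU/set0]_(c <- large_cubes f m K) cube c.1 c.2.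
Proof.
move=> mf; apply/seteqP; split=> [x /= /lt_frac_maximalP[c [c0 cx mc]]|].
  have [q [q0 cq mq]] := rational_cube_enlarge mf c0 mc.
  exists (pickle q).+1 => //; rewrite -bigcup_seq.
  exists (rational_cube q); last exact: cq.
  rewrite /= mem_pmap; apply/mapP; exists (pickle q).
    by rewrite mem_iota add0n ltnSn.
  by rewrite pickleK q0 mq.
move=> x [K _]; rewrite -bigcup_seq => -[c /= cK cx].
by have [c0 mc] := large_cubesP cK; apply/lt_frac_maximalP; exists c.
Qed.

Lemma measurable_frac_maximal f : measurable_fun setT f ->
  measurable_fun setT (frac_maximal gamma f).
Proof.
move=> mf; apply: measurable_fun_gtP => m.
rewrite setTI lt_frac_maximal_bigcup//.
apply: bigcupT_measurable => K; apply: bigsetU_measurable => c _.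
exact: measurable_cube.
Qed.

Lemma frac_maximal_ge0 f x : 0 <= frac_maximal gamma f x.
Proof.
apply: le_ereal_sup_tmp.
exists (cube_average f ([tuple tnth x i | i < n], 1%R)).
  exists (cube [tuple tnth x i | i < n] 1%R).
    exists [tuple tnth x i | i < n], 1%R; split => // i.
    by rewrite tnth_mktuple lexx lerDl/=.
  by rewrite lebn_cube// /cube_average/= -powRN opprB.
exact: cube_average_ge0.
Qed.

End fractional_maximal.

(** * Upper bound for the fractional maximal function *)

Section upper_bound.
Variables (R : realType) (n : nat) (gamma : R).
Hypothesis gamma_n : (0 < gamma < n%:R)%R.
Local Notation alpha := (gamma / n%:R)%R.
Local Notation ER := (euclidean R n).
Local Notation mu := (lebn R n).
Implicit Types (f : ER -> \bar R) (l m t : R).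

Let measurable_cubes (c : n.-tuple R * R) : measurable (cube c.1 c.2).
Proof. exact: measurable_cube. Qed.

Lemma cube_average_gt_integral f (c : n.-tuple R * R) m : (0 < c.2)%R ->
  m%:E < cube_average gamma f c ->
  (m * (c.2 ^+ n) `^ (1 - alpha))%:E <= \int[mu]_(y in cube c.1 c.2) `|f y|.
Proof.
move=> c0; rewrite /cube_average -[(alpha - 1)%R]opprB powRN.
by rewrite lte_pdivlMl ?powR_gt0 ?exprn_gt0// -EFinM mulrC => /ltW.
Qed.

(** The heart of the upper bound. Among finitely many cubes that cover a
    part of measure above t, disjoint ones are selected whose triples still
    cover it; s is their total volume. On each of them the integral of |f|
    is at least m |Q|^(1 - alpha), and these bounds add up. *)
Lemma lt_measure_frac_maximal f m t : measurable_fun setT f -> (0 <= m)%R ->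
  (0 <= t)%R -> t%:E < mu [set x | m%:E < frac_maximal gamma f x] ->
  exists s, [/\ (0 < s)%R, (t < 3 ^+ n * s)%R &
    (m * s `^ (1 - alpha))%:E <= rearr_int mu setT f s].
Proof.
move=> mf m0 t0; rewrite lt_frac_maximal_bigcup// => /lt_measure_bigcup[].
- by move=> K; exact: measurable_bigsetU.
- move=> K K' KK'; apply/subsetPset; rewrite -!bigcup_seq => x [c /= cK cx].
  by exists c => //=; exact: sub_large_cubes cK.
move=> K tK; have cK0 c : c \in large_cubes gamma f m K -> (0 < c.2)%R.
  by move=> /large_cubesP[].
have [s [sK ds cover]] := vitali_cubes cK0.
have s0 c : c \in s -> (0 < c.2)%R by move=> /sK /cK0.
pose v := (\sum_(c <- s) c.2 ^+ n)%R.
have tv : (t < 3 ^+ n * v)%R.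
  rewrite -lte_fin; apply: (lt_le_trans tK).
  apply: (@le_trans _ _ (mu (\big[setU/set0]_(c <- s) triple_cube c))).
    apply: subset_measure_le; first exact: measurable_bigsetU.
      by apply: measurable_bigsetU => c; exact: measurable_cube.
    rewrite -!bigcup_seq => x [c /= /cover[c' c's cc'] cx].
    by exists c' => //; exact: cc'.
  apply: le_trans (measure_bigsetU_le _ _ _) _.
    by move=> c; exact: measurable_cube.
  rewrite /v mulr_sumr -sumEFin big_seq [leRHS]big_seq lee_sum// => c cs.
  rewrite -exprMn le_eqVlt; apply/orP; left; apply/eqP.
  by apply: lebn_cube; rewrite mulr_ge0// ltW// s0.
have v0 : (0 < v)%R.
  by rewrite -(pmulr_rgt0 v (exprn_gt0 n (ltr0Sn R 2))) (le_lt_trans t0).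
exists v; split => //.
apply: (@le_trans _ _ (\sum_(c <- s) \int[mu]_(y in cube c.1 c.2) `|f y|)).
  apply: (@le_trans _ _ (\sum_(c <- s) (m * (c.2 ^+ n) `^ (1 - alpha))%:E)).
    rewrite sumEFin lee_fin -mulr_sumr ler_wpM2l//.
    apply: powR_sum_le; last by move=> c cs; rewrite exprn_gt0// s0.
    have /andP[a0 a1] := exponent_gt0_lt1 gamma_n.
    by rewrite subr_gt0 a1 gerBl ltW.
  rewrite big_seq [leRHS]big_seq lee_sum// => c cs.
  by have [c0 mc] := large_cubesP (sK _ cs); exact: cube_average_gt_integral.
rewrite -integral_bigsetU_disjoint//.
- apply: hardy_littlewood => //; first exact: measurable_bigsetU.
  apply: le_trans (measure_bigsetU_le _ _ _) _ => //.
  rewrite /v -sumEFin big_seq [leRHS]big_seq lee_sum// => c cs.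
  rewrite le_eqVlt; apply/orP; left; apply/eqP.
  by apply: lebn_cube; rewrite ltW// s0.
- exact: measurable_fun_abse.
Qed.

(** A point s with fractional average at least m yields an interval of
    length 3^n s, longer than t, on which the fractional average is at least
    m (1 + 3^n)^(alpha - 1); so its rearrangement at t is at least that
    large. *)
Lemma rearr_frac_maximal_le f t : measurable_fun setT f -> (0 < t)%R ->
  rearr mu setT (frac_maximal gamma f) t <=
  ((1 + 3 ^+ n) `^ (1 - alpha))%:E *
  rearr (leb1 R) (posR R) (frac_average mu setT alpha f) t.
Proof.
move=> mf t0; set g := frac_average _ _ _ _.
have [mg g0] := Mplus_frac_average mu setT alpha f.
have mM := measurable_frac_maximal gamma_n mf.
set k := ((1 + 3 ^+ n) `^ (1 - alpha))%R.
have c0 : (0 < 1 + 3 ^+ n :> R)%R by rewrite addr_gt0// exprn_gt0.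
have k0 : (0 < k)%R by rewrite powR_gt0.
rewrite leNgt; apply/negP => kg.
have := rearr_ge0 (leb1 R) (posR R) g t.
case gE : (rearr (leb1 R) (posR R) g t) kg => [r| |]//; last first.
  by rewrite gt0_muley ?lte_fin// ltNge leey.
rewrite -EFinM => kr; rewrite lee_fin => r0.
have kr0 : (0 <= k * r)%R by rewrite mulr_ge0// ltW.
(* the strict inequality at m is what makes the one for r strict below *)
have [m krm mM'] : exists2 m, (k * r < m)%R &
    m%:E < rearr mu setT (frac_maximal gamma f) t.
  have := kr; rewrite lt_rearrP// => /(distr_lt_right _ mM)[//|m krm tm].
  by exists m => //; rewrite lt_rearrP// ltW// (le_lt_trans kr0).
have m0 : (0 <= m)%R by rewrite ltW// (le_lt_trans kr0).
move: mM'; rewrite lt_rearrP// /distr setTI => tm.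
have : t%:E < mu [set x | m%:E < frac_maximal gamma f x].
  apply: (lt_le_trans tm); rewrite le_eqVlt; apply/orP; left; apply/eqP.
  congr (mu _); apply/seteqP.
  by split => x /=; rewrite gee0_abs// frac_maximal_ge0.
move=> /(lt_measure_frac_maximal mf m0 (ltW t0))[s [s0 ts ms]].
have gs : m%:E <= g s.
  rewrite /g frac_averageE// -[(alpha - 1)%R]opprB powRN.
  by rewrite lee_pdivlMl ?powR_gt0// -EFinM mulrC.
have : r%:E < rearr (leb1 R) (posR R) g t.
  rewrite lt_rearrP//; last exact: measurable_posR.
  rewrite /distr.
  apply: (@lt_le_trans _ _ (leb1 R `[s, (s + 3 ^+ n * s)%R]%classic)).
    rewrite leb1_lebesgue_measure lebesgue_measure_itv/= lte_fin ltrDl.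
    rewrite mulr_gt0 ?exprn_gt0// -EFinB lte_fin addrAC subrr add0r//.
  apply: subset_measure_le.
  - by apply: measurable_real_line; exact: measurable_itv.
  - by apply: measurable_gt_abse => //; exact: measurable_posR.
  move=> u /=; rewrite in_itv/= => /andP[su us].
  have u0 : (0 < u)%R by exact: lt_le_trans su.
  split; first exact/posRE.
  rewrite gee0_abs; last exact/g0/posRE.
  apply: lt_le_trans (frac_average_ge _ _ _ _ s0 su).
  apply: (@lt_le_trans _ _ ((u / s) `^ (alpha - 1) * m)%:E); last first.
    by rewrite EFinM lee_wpmul2l// lee_fin powR_ge0.
  rewrite lte_fin.
  have us0 : (0 < u / s)%R by rewrite divr_gt0.
  rewrite -[(alpha - 1)%R]opprB powRN ltr_pdivlMl ?powR_gt0//.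
  apply: le_lt_trans krm; rewrite ler_wpM2r//.
  apply: ge0_ler_powR.
  - by rewrite subr_ge0; case/andP: (exponent_ge0_le1 gamma_n).
  - by rewrite nnegrE ltW.
  - by rewrite nnegrE ltW.
  - by rewrite ler_pdivrMr// mulrDl mul1r.
by rewrite gE ltxx.
Qed.

End upper_bound.

(** * Symmetrization on centred cubes *)

Section centred_cubes.
Variables (R : realType) (n : nat).
Hypothesis n0 : (0 < n)%N.
Implicit Types (s t : R) (x : n.-tuple R).

Definition edge s : R := s `^ n%:R^-1.

Definition centred_cube s : set (euclidean R n) :=
  cube [tuple (- (edge s / 2))%R | i < n] (edge s).

(** The volume of the smallest centred cube that contains x; it takes the
    place of the volume of the Euclidean ball of radius |x|. *)
Definition radial_volume x : R :=
  ((2 * \big[Order.max/0%R]_(i < n) `|tnth x i|) ^+ n)%R.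

Lemma edge_ge0 s : (0 <= edge s)%R.
Proof. exact: powR_ge0. Qed.

Lemma edgeX s : (0 <= s)%R -> (edge s ^+ n = s)%R.
Proof.
move=> s0; rewrite /edge -powR_mulrn ?powR_ge0// -powRrM mulVf ?powRr1//.
by rewrite pnatr_eq0 -lt0n.
Qed.

Lemma measurable_centred_cube s : measurable (centred_cube s).
Proof. exact: measurable_cube. Qed.

Lemma lebn_centred_cube s : (0 <= s)%R -> lebn R n (centred_cube s) = s%:E.
Proof. by move=> s0; rewrite lebn_cube ?edge_ge0// edgeX. Qed.

Lemma centred_cubeP s x : (0 <= s)%R ->
  centred_cube s x <-> (radial_volume x <= s)%R.
Proof.
move=> s0; rewrite /radial_volume -[X in (_ <= X)%R](edgeX s0).
have max0 : (0 <= \big[Order.max/0%R]_(i < n) `|tnth x i|)%R.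
  exact: bigmax_ge_id.
rewrite ler_pXn2r ?nnegrE ?edge_ge0 ?mulr_ge0// mulrC -ler_pdivlMr//.
split=> [cx|/bigmax_leP[_ xs] i].
  apply/bigmax_leP; split=> [|i _]; first by rewrite divr_ge0 ?edge_ge0.
  have := cx i; rewrite tnth_mktuple ler_norml => /andP[-> xi] /=.
  by apply: (le_trans xi); lra.
have := xs i isT; rewrite tnth_mktuple ler_norml => /andP[-> xi] /=.
by apply: (le_trans xi); lra.
Qed.

Lemma radial_volume_ge0 x : (0 <= radial_volume x)%R.
Proof. by rewrite exprn_ge0// mulr_ge0//; exact: bigmax_ge_id. Qed.

Lemma measurable_radial_volume :
  measurable_fun setT (fun x : euclidean R n => (radial_volume x)%:E).
Proof.
apply: measurable_fun_gtP => l; rewrite setTI.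
have [l0|l0] := leP 0%R l.
  rewrite (_ : [set _ | _] = ~` centred_cube l).
    by apply: measurableC; exact: measurable_centred_cube.
  apply/seteqP; split => x /=; rewrite lte_fin ltNge.
    by move=> /negP H /(centred_cubeP _ l0).
  by move=> H; apply/negP => /(centred_cubeP _ l0).
rewrite (_ : [set _ | _] = setT); first exact: measurableT.
apply/seteqP; split => x //= _.
by rewrite lte_fin (lt_le_trans l0)// radial_volume_ge0.
Qed.

Lemma measurable_radial_volume_lt (m : \bar R) :
  measurable [set x : euclidean R n | (radial_volume x)%:E < m].
Proof.
rewrite -[X in measurable X]setTI.
exact: (emeasurable_fun_infty_o measurableT measurable_radial_volume).
Qed.

Lemma lebn_radial_volume_lt (m : \bar R) : 0 <= m ->
  lebn R n [set x : euclidean R n | (radial_volume x)%:E < m] = m.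
Proof.
move=> m0; apply: eq_ereal_gt => //.
move=> l l0; apply/idP/idP => [/lt_le_trans|]; last first.
  move=> /lte_between[s ls sm]; have s0 := le_trans l0 (ltW ls).
  apply: (@lt_le_trans _ _ s%:E); first by rewrite lte_fin.
  rewrite -(lebn_centred_cube s0); apply: subset_measure_le.
  - exact: measurable_centred_cube.
  - exact: measurable_radial_volume_lt.
  - move=> x /(centred_cubeP _ s0) xs /=.
    by apply: le_lt_trans sm; rewrite lee_fin.
apply; case: m m0 => [m| |]// m0; last exact: leey.
rewrite -[leRHS](lebn_centred_cube m0); apply: subset_measure_le.
- exact: measurable_radial_volume_lt.
- exact: measurable_centred_cube.
- by move=> x /=; rewrite lte_fin => xm; apply/centred_cubeP => //; exact: ltW.
Qed.

End centred_cubes.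

Arguments edge {R} n s.
Arguments centred_cube {R} n s.

Section symmetrization.
Variables (R : realType) (n : nat).
Hypothesis n0 : (0 < n)%N.
Local Notation ER := (euclidean R n).
Local Notation mu := (lebn R n).
Implicit Types (f : ER -> \bar R) (s t : R).

(** The function equimeasurable with f whose level sets are centred cubes.
    Cubes serve as balls here since the supremum in the fractional maximal
    function is over cubes. *)
Definition symmetrization f (x : ER) : \bar R :=
  rearr mu setT f (radial_volume x).

Lemma symmetrization_ge0 f x : 0 <= symmetrization f x.
Proof. exact: rearr_ge0. Qed.

Lemma symmetrization_gtE f l : measurable_fun setT f -> (0 <= l)%R ->
  [set x | l%:E < symmetrization f x] =
  [set x : ER | (radial_volume x)%:E < distr mu setT f l].
Proof.
by move=> mf l0; apply/seteqP; split => x /=; rewrite /symmetrization lt_rearrP.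
Qed.

Lemma measurable_symmetrization f : measurable_fun setT f ->
  measurable_fun setT (symmetrization f).
Proof.
move=> mf; apply: measurable_fun_gtP => l; rewrite setTI.
have [l0|l0] := leP 0%R l.
  by rewrite symmetrization_gtE//; exact: measurable_radial_volume_lt.
rewrite (_ : [set _ | _] = setT); first exact: measurableT.
apply/seteqP; split => x //= _; apply: (@lt_le_trans _ _ 0).
  by rewrite lte_fin.
exact: symmetrization_ge0.
Qed.

Lemma rearr_symmetrization f t : measurable_fun setT f ->
  rearr mu setT (symmetrization f) t = rearr mu setT f t.
Proof.
move=> mf; have ms := measurable_symmetrization mf.
apply: eq_ereal_gt; try exact: rearr_ge0.
move=> l l0; rewrite !lt_rearrP//; congr (_ < _); rewrite {1}/distr setTI.
rewrite -[RHS](lebn_radial_volume_lt n0 (distr_ge0 mu setT f l)).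
rewrite -symmetrization_gtE//; congr (mu _); apply/seteqP.
by split => x /=; rewrite gee0_abs ?symmetrization_ge0.
Qed.

(** On the centred cube of volume s the symmetrization has the same
    distribution function as f* on (0, s): at each level both are the
    minimum of s and the distribution function of f. *)
Lemma integral_symmetrization f s : measurable_fun setT f -> (0 < s)%R ->
  \int[mu]_(x in centred_cube n s) `|symmetrization f x| =
  rearr_int mu setT f s.
Proof.
move=> mf s0; under eq_integral do rewrite gee0_abs ?symmetrization_ge0//.
apply: (@eq_integral_distribution _ _ _ _ _ mu (leb1 R)).
- exact: measurable_centred_cube.
- exact: measurable_itv0t.
- by apply: measurable_funTS; exact: measurable_symmetrization.
- exact: measurable_rearr_itv0t.
- by move=> x _; exact: symmetrization_ge0.
- by move=> x _; exact: rearr_ge0.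
move=> l l0; rewrite symmetrization_gtE//.
rewrite (_ : `]0%R, s[%classic `&` _ =
    `]0%R, s[%classic `&` [set u | u%:E < distr mu setT f l]); last first.
  by apply/seteqP; split => x [xs /=]; rewrite lt_rearrP.
have := distr_ge0 mu setT f l.
have [ms|sm] := leP (distr mu setT f l) s%:E.
  case: (distr _ _ _ _) ms => [m| |]//; rewrite !lee_fin => ms m0.
  rewrite (_ : centred_cube n s `&` _ =
      [set x : ER | (radial_volume x)%:E < m%:E]); last first.
    apply/seteqP; split=> [x [_ /=]//|x /= xm]; split => //.
    apply/centred_cubeP => //; first exact: ltW.
    by move: xm; rewrite lte_fin => /ltW/le_trans; apply.
  transitivity m%:E; first exact: lebn_radial_volume_lt.
  rewrite -[LHS](leb1_itv0t m0); apply: (congr1 (leb1 R)); apply/seteqP.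
  split => u /=; rewrite !in_itv/= lte_fin.
    by move=> /andP[u0 um]; rewrite u0 um (lt_le_trans um).
  by move=> [/andP[-> _] ->].
move=> _.
rewrite setIidl; last first.
  move=> x /(centred_cubeP n0 _ (ltW s0)) xs /=.
  by apply: le_lt_trans sm; rewrite lee_fin.
rewrite setIidl; last first.
  move=> u /=; rewrite in_itv/= => /andP[_ us].
  by apply: lt_trans sm; rewrite lte_fin.
transitivity s%:E; first exact: lebn_centred_cube (ltW s0).
exact/esym/leb1_itv0t/ltW.
Qed.

End symmetrization.

(** * Lower bound for the fractional maximal function *)

Section lower_bound.
Variables (R : realType) (n : nat) (gamma : R).
Hypothesis gamma_n : (0 < gamma < n%:R)%R.
Local Notation alpha := (gamma / n%:R)%R.
Local Notation ER := (euclidean R n).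
Local Notation mu := (lebn R n).
Implicit Types (f : ER -> \bar R) (s t : R).

Let n0 : (0 < n)%N := dim_gt0 gamma_n.

Lemma frac_maximal_ge_centred f s x : (0 < s)%R -> centred_cube n s x ->
  (s `^ (alpha - 1))%:E * \int[mu]_(y in centred_cube n s) `|f y| <=
  frac_maximal gamma f x.
Proof.
move=> s0 sx; rewrite leNgt; apply/negP => H.
suff : frac_maximal gamma f x < frac_maximal gamma f x by rewrite ltxx.
apply/lt_frac_maximalP.
exists ([tuple (- (edge n s / 2))%R | i < n], edge n s); split => //=.
  by rewrite powR_gt0.
by rewrite /cube_average/= edgeX// ltW.
Qed.

(** The centred cube of volume s contains each of its points, so it is a
    competitor for the supremum at all of them, and its volume exceeds t. *)
Lemma rearr_frac_maximal_ge f s t : measurable_fun setT f -> (0 <= t < s)%R ->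
  (s `^ (alpha - 1))%:E * \int[mu]_(y in centred_cube n s) `|f y| <=
  rearr mu setT (frac_maximal gamma f) t.
Proof.
move=> mf /andP[t0 ts]; have s0 := le_lt_trans t0 ts.
set A := (X in X <= _); rewrite leNgt; apply/negP => H.
have mM := measurable_frac_maximal gamma_n mf.
have := rearr_ge0 mu setT (frac_maximal gamma f) t.
case E : (rearr _ _ _ _) H => [r| |]//; last by rewrite ltNge leey.
rewrite lee_fin => rA r0.
suff : r%:E < rearr mu setT (frac_maximal gamma f) t by rewrite E ltxx.
rewrite lt_rearrP// /distr setTI; apply: (@lt_le_trans _ _ s%:E).
  by rewrite lte_fin.
rewrite -(lebn_centred_cube n0 (ltW s0)); apply: subset_measure_le.
- exact: measurable_centred_cube.
- by have := measurable_gt_abse measurableT r mM; rewrite setTI.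
move=> x sx /=; rewrite gee0_abs ?frac_maximal_ge0//.
by apply: (lt_le_trans rA); exact: frac_maximal_ge_centred.
Qed.

(** A cube of volume strictly larger than t is required, whence the passage
    from t to 2t and the factor lost in it. *)
Lemma frac_average_le_symmetrization f t : measurable_fun setT f -> (0 < t)%R ->
  frac_average mu setT alpha f t <=
  (2 `^ (1 - alpha))%:E *
  rearr mu setT (frac_maximal gamma (symmetrization f)) t.
Proof.
move=> mf t0; have t2 : (0 <= t < 2 * t)%R by rewrite ltW//=; lra.
have t2_gt0 : (0 < 2 * t)%R by rewrite mulr_gt0.
have := rearr_frac_maximal_ge (measurable_symmetrization n0 mf) t2.
rewrite integral_symmetrization// -frac_averageE//.
rewrite -[(1 - alpha)%R]opprB powRN.
rewrite lee_pdivlMl ?powR_gt0//; apply: le_trans.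
have := @frac_average_ge _ _ _ mu setT alpha f t (2 * t)%R t0.
by rewrite mulfK ?gt_eqF//; apply; lra.
Qed.

End lower_bound.

(** * Norm inequalities and the theorem *)

Section frac_maximal_in_norm.
Variables (R : realType) (n : nat) (gamma : R).
Hypothesis gamma_n : (0 < gamma < n%:R)%R.
Local Notation alpha := (gamma / n%:R)%R.
Local Notation ER := (euclidean R n).
Local Notation mu := (lebn R n).
Variable rhob : (real_line R -> \bar R) -> \bar R.
Hypothesis rin : ri_norm (leb1 R) (posR R) rhob.
Implicit Types (f : ER -> \bar R).
Local Notation sigma := (frac_average_norm mu setT alpha rhob).

Let n0 : (0 < n)%N := dim_gt0 gamma_n.

Let Mrearr f : Mplus (posR R) (rearr mu setT f).
Proof. by split; [exact: measurable_rearr|move=> *; exact: rearr_ge0]. Qed.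

Lemma frac_average_norm_rearr f :
  sigma f = rhob (rearr (leb1 R) (posR R) (frac_average mu setT alpha f)).
Proof.
have Mg := Mplus_frac_average mu setT alpha f.
apply: (ri_norm_rearr rin Mg) => [|t t0].
  by split; [exact: measurable_rearr|move=> *; exact: rearr_ge0].
by apply/esym/rearr_rearr; [exact: measurable_posR|exact: Mg.1].
Qed.

Lemma ri_norm_frac_maximal_le f : measurable_fun setT f ->
  rhob (rearr mu setT (frac_maximal gamma f)) <=
  ((1 + 3 ^+ n) `^ (1 - alpha))%:E * sigma f.
Proof.
move=> mf; rewrite frac_average_norm_rearr.
set g := rearr (leb1 R) (posR R) _.
have Mg : Mplus (posR R) g.
  by split; [exact: measurable_rearr|move=> *; exact: rearr_ge0].
have k0 : (0 <= (1 + 3 ^+ n) `^ (1 - alpha))%R by exact: powR_ge0.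
rewrite -(ri_normZ rin Mg k0).
apply: (ri_norm_le_pos rin (Mrearr _) (MplusZ k0 Mg)) => t t0.
exact: rearr_frac_maximal_le.
Qed.

Lemma frac_average_norm_le_frac_maximal f : measurable_fun setT f ->
  sigma f <= (2 `^ (1 - alpha))%:E *
    rhob (rearr mu setT (frac_maximal gamma (symmetrization f))).
Proof.
move=> mf; have k0 : (0 <= 2 `^ (1 - alpha))%R by exact: powR_ge0.
rewrite -(ri_normZ rin (Mrearr _) k0).
have Mg := Mplus_frac_average mu setT alpha f.
apply: (ri_norm_le_pos rin Mg (MplusZ k0 (Mrearr _))) => t t0.
exact: frac_average_le_symmetrization.
Qed.

(** The indicator of the unit cube has integral 1 over the centred cube of
    volume 1 + t, however small t is; using volume 1 + t instead of t keeps
    the bound away from 0 near the origin. *)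
Lemma shifted_power_norm_le :
  rhob (fun t => ((1 + t) `^ (alpha - 1))%:E) <=
  rhob (rearr mu setT
    (frac_maximal gamma (fun x => (\1_(centred_cube n 1%R) x)%:E))).
Proof.
apply: (ri_norm_le_pos rin (Mplus_shifted_power _) (Mrearr _)) => t t0.
have t1 : (0 <= t < 1 + t)%R by rewrite ltW//= ltrDr.
have t10 : (0 <= 1 + t)%R by rewrite addr_ge0// ltW.
have mQ : measurable (centred_cube n (1%R : R)).
  exact: measurable_centred_cube.
set f := (fun x => _); have mf : measurable_fun setT f.
  by apply/measurable_EFinP; exact: measurable_indic.
have := rearr_frac_maximal_ge gamma_n mf t1.
rewrite (_ : \int[mu]_(y in _) _ = 1) ?mule1//.
rewrite (_ : (fun y => `|f y|) = f); last first.
  by apply/funext => x; rewrite gee0_abs// lee_fin.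
have mQt : measurable (centred_cube n (1 + t)%R).
  exact: measurable_centred_cube.
rewrite (integral_indic _ mQt mQ).
rewrite setIidl; first exact: (lebn_centred_cube n0 ler01).
move=> x /(centred_cubeP n0 _ ler01) x1; apply/centred_cubeP => //.
by rewrite (le_trans x1)// lerDl ltW.
Qed.

End frac_maximal_in_norm.

Theorem theorem4p4 (R : realType) (n : nat) (gamma : R)
    (rhoY : (euclidean R n -> \bar R) -> \bar R)
    (rhoYbar : (real_line R -> \bar R) -> \bar R) :
  (0 < gamma < n%:R)%R ->
  ri_norm (lebn R n) setT rhoY ->
  representation rhoY rhoYbar ->
  let psi (t : R) : \bar R := ((1 + t) `^ (gamma / n%:R - 1))%:E in
  let sigma (f : euclidean R n -> \bar R) : \bar R :=
    rhoYbar (fun t => (t `^ (gamma / n%:R))%:E * rearr2 (lebn R n) setT f t) in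
  let M_bounded (rhoX : (euclidean R n -> \bar R) -> \bar R) : Prop :=
    bounded_op setT setT rhoX rhoY (frac_maximal gamma) in
  (ri_space (posR R) rhoYbar psi ->
    [/\ ri_norm (lebn R n) setT sigma,
        M_bounded sigma &
        forall rhoZ : (euclidean R n -> \bar R) -> \bar R,
          ri_norm (lebn R n) setT rhoZ -> M_bounded rhoZ ->
          bounded_op setT setT rhoZ sigma id]) /\
  (~ ri_space (posR R) rhoYbar psi ->
    ~ exists rhoX : (euclidean R n -> \bar R) -> \bar R,
        ri_norm (lebn R n) setT rhoX /\ M_bounded rhoX).
Proof.
move=> gamma_n _ [rinY reprY] psi sigma M_bounded.
have a01 := exponent_ge0_le1 gamma_n.
have n0 := dim_gt0 gamma_n.
have psiE : (fun t => `|psi t|) = psi.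
  by apply/funext => t; rewrite gee0_abs// lee_fin powR_ge0.
have Mpsi : Mplus (posR R) psi := Mplus_shifted_power _.
have sigmaE f : sigma (fun x => `|f x|) =
    frac_average_norm (lebn R n) setT (gamma / n%:R) rhoYbar f.
  by apply: (frac_average_norm_eq _ rinY) => t _; exact: rearr_abs.
split.
  move=> [_]; rewrite psiE => psi_fin; split.
  - exact: (ri_norm_frac_average (lebn R n) measurableT a01 rinY psi_fin).
  - exists ((1 + 3 ^+ n) `^ (1 - gamma / n%:R))%R.
      by rewrite powR_gt0// addr_gt0// exprn_gt0.
    move=> f [mf _]; have mMf := measurable_frac_maximal gamma_n mf.
    split => //.
    by rewrite sigmaE (reprY _ mMf); exact: ri_norm_frac_maximal_le.
  - move=> rhoZ rinZ [C C0 HC].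
    exists (2 `^ (1 - gamma / n%:R) * C)%R.
      by rewrite mulr_gt0// powR_gt0.
    move=> f [mf fZ]; split => //.
    have mf' := measurable_symmetrization n0 mf.
    have Zf' : rhoZ (fun x => `|symmetrization f x|) = rhoZ (fun x => `|f x|).
      apply: (ri_norm_rearr rinZ (Mplus_abs mf') (Mplus_abs mf)) => t _.
      by rewrite !rearr_abs rearr_symmetrization.
    have [|mMf'] := HC (symmetrization f); first by split => //; rewrite Zf'.
    rewrite (reprY _ mMf') Zf' => Mf'Z.
    rewrite sigmaE EFinM -muleA.
    apply: le_trans (frac_average_norm_le_frac_maximal gamma_n rinY mf) _.
    by rewrite lee_wpmul2l// lee_fin powR_ge0.
move=> npsi [rhoX [rinX [C C0 HC]]]; apply: npsi; split; first exact: Mpsi.1.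
pose Q := centred_cube n (1 : R)%R.
pose f (x : euclidean R n) := (\1_Q x)%:E : \bar R.
have mQ : measurable Q by exact: measurable_centred_cube.
have Qfin : lebn R n Q < +oo by rewrite lebn_centred_cube// ltry.
have mf : measurable_fun setT f.
  by apply/measurable_EFinP; exact: measurable_indic.
have fX : rhoX (fun x => `|f x|) < +oo.
  rewrite (_ : (fun x => _) = f); last first.
    by apply/funext => x; rewrite gee0_abs// lee_fin.
  exact: (ri_norm_indic rinX mQ (@subsetT _ Q) Qfin).
have [mMf] := HC f (conj mf fX); rewrite (reprY _ mMf) => Mf_le.
rewrite psiE; apply: le_lt_trans (shifted_power_norm_le gamma_n rinY) _.
by apply: (le_lt_trans Mf_le); rewrite lte_mul_pinfty// lee_fin ltW.
Qed.
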